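(* Let $\theta^\star$ denote the minimizer of the primal function $F:x\in\mathbb{R}^d\mapsto\sum_{i=1}^nf_i(x)$ and $\theta^\star_A$ a minimizer of the dual function $F_A^*=q_A+\psi$. Let $\rho>0$ satisfy $$\rho^2\le\min_b\frac{\lambda_{\min}^+(A^\top\Sigma^\dagger A)}{\lambda_{\max}(A^\dagger AP_b^\dagger A^\top\Sigma^\dagger AP_b^\dagger A^\dagger A)},$$ the minimum being over the blocks $b$ of edges that may be sampled. Then $\theta_t=\Sigma^\dagger v_t$, as output by the ADFS algorithm with parameter $\rho$ after $t$ iterations, satisfies $$\mathbb{E}\left[\|\theta_t-\theta^\star\|^2\right]\le C_0(1-\rho)^t,$$ with $C_0=\lambda_{\max}\big(A^\top(\Sigma^\dagger)^2A\big)\left[\|A^\dagger A\theta^\star_A\|^2+2\sigma_A^{-1}\left(F_A^*(0)-F_A^*(\theta_A^\star)\right)\right]$, where $\|\theta_t-\theta^\star\|^2$ stands for $\sum_{i=1}^n\|\theta_t^{(i)}-\theta^\star\|^2$, the sum being over the $n$ communication nodes.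
   Context: Problem. A connected communication graph has $n$ nodes and $E$ edges. Node $i$ holds $f_i(\theta)=\sum_{j=1}^mf_{i,j}(\theta)+\frac{\sigma_i}{2}\|\theta\|^2$, $\theta\in\mathbb{R}^d$, $\sigma_i>0$, with $f_{i,j}$ convex and $L_{i,j}$-smooth ($L_{i,j}>0$) with respect to an orthogonal projector $P_{ij}\in\mathbb{R}^{d\times d}$, i.e. $f_{i,j}(x)-f_{i,j}(y)\le\nabla f_{i,j}(y)^\top P_{ij}(x-y)+\frac{L_{i,j}}2(x-y)^\top P_{ij}(x-y)$ for all $x,y$ (so the Fenchel conjugate $f_{i,j}^*$ is $(1/L_{i,j})$-strongly convex on $\mathrm{Ker}(P_{ij})^\perp$ and $+\infty$ elsewhere). $\|x\|_Q^2=x^\top Qx$; $\lambda^+_{\min}$ is the smallest non-zero eigenvalue; $^\dagger$ is the pseudo-inverse; $\mathrm{prox}_{\eta f}(x)=\arg\min_v\frac1{2\eta}\|v-x\|^2+f(v)$. Augmented graph. It has the $n$ communication nodes $i$, and $nm$ virtual nodes $(i,j)$, $1\le j\le m$; its edges are the $E$ communication edges and the $nm$ virtual edges joining $i$ to $(i,j)$ (denoted simply $(i,j)$). Node vectors $x\in\mathbb{R}^{n(1+m)d}$ have blocks $x^{(k)}\in\mathbb{R}^d$, edge vectors $\lambda\in\mathbb{R}^{(E+nm)d}$ have blocks $\lambda_{k\ell}\in\mathbb{R}^d$; $e^{(k)}$ and $e_{k\ell}$ are the unit vectors of $\mathbb{R}^{n(1+m)}$ and $\mathbb{R}^{E+nm}$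 associated with node $k$ and edge $(k,\ell)$. Fix weights $\mu_{k\ell}>0$. The matrix $A\in\mathbb{R}^{n(1+m)d\times(E+nm)d}$ is defined by $A(e_{k\ell}\otimes x)=\mu_{k\ell}\,(e^{(k)}-e^{(\ell)})\otimes P_{k\ell}x$ for $x\in\mathbb{R}^d$, with $P_{k\ell}=I_d$ for communication edges, and with $k=i$, $\ell=(i,j)$, $P_{k\ell}=P_{ij}$, $\mu_{k\ell}=\mu_{ij}$ for virtual edges. $\Sigma$ is the block-diagonal matrix with blocks $\sigma_iI_d$ at communication nodes $i$ and $L_{i,j}P_{ij}$ at virtual nodes $(i,j)$. $\sigma_A=\lambda_{\min}^+(A^\top\Sigma^\dagger A)$. Dual problem. $\tilde f^*_{ij}(x)=f_{i,j}^*(x)-\frac1{2L_{i,j}}\|x\|^2_{P_{ij}}$, $\psi_{ij}(x)=\tilde f^*_{ij}(-\mu_{ij}x)$, $\psi(\lambda)=\sum_{i=1}^n\sum_{j=1}^m\psi_{ij}(\lambda_{ij})$, $q_A(\lambda)=\frac12\lambda^\top A^\top\Sigma^\dagger A\lambda$; $F_A^*=q_A+\psi$ on $\mathbb{R}^{(E+nm)d}$. Sampling. At each iteration a block $b$ of edges of the augmented graph is drawn (independently of the past) with probability $p_b$; each block consists either only of communication edges or only of virtual edges. $p_{k\ell}=\sum_{b\ni(k,\ell)}p_b>0$. $P_b$ is the diagonal matrix with entry $p_{k\ell}$ at edge $(k,\ell)\in b$ and $0$ at edges not in $b$ (acting on $\mathbb{R}^{(E+nm)d}$ as $P_b\otimes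 I_d$). $W_b=AP_b^\dagger A^\top$, $\tilde W_b=AP_b^\dagger A^\dagger$. ADFS algorithm with parameter $\rho$: $\eta=\rho/\sigma_A$, $x_0=y_0=v_0=z_0=0$; for $t\ge0$: - $y_t=\frac1{1+\rho}(x_t+\rho v_t)$; - sample a block $b$ of edges; - $z_{t+1}=(1-\rho)v_t+\rho y_t-\eta W_b\Sigma^\dagger y_t$, and set $v_{t+1}=z_{t+1}$; - if $b$ is a block of virtual edges, then for each $i$: for each $j$ with $(i,j)\in b$ set $v_{t+1}^{(i,j)}=\mathrm{prox}_{\eta\mu_{ij}^2p_{ij}^{-1}\tilde f^*_{ij}}\big(z_{t+1}^{(i,j)}\big)$, and set $v_{t+1}^{(i)}=z_{t+1}^{(i)}+\sum_{j:(i,j)\in b}\big(z_{t+1}^{(i,j)}-v_{t+1}^{(i,j)}\big)$; - $x_{t+1}=y_t+\rho\tilde W_b\big(v_{t+1}-(1-\rho)v_t-\rho y_t\big)$. Output after $t$ iterations: $\theta_t=\Sigma^\dagger v_t$. *)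

(* Defs.v *)
From HB Require Import structures.
From mathcomp Require Import all_boot all_order all_algebra.
From mathcomp Require Export mxtens.
From mathcomp Require Import all_classical all_reals all_analysis.

Set Implicit Arguments.
Unset Strict Implicit.
Unset Printing Implicit Defensive.

Import Order.TTheory GRing.Theory Num.Theory.
Import numFieldNormedType.Exports.

Local Open Scope classical_set_scope.
Local Open Scope ring_scope.

Section LinearAlgebra.
Context {R : realType}.

(* Mathcomp's matrix norm is the sup norm, so the Euclidean one is spelled out. *)
Definition qform k (Q : 'M[R]_k) (x : 'cV[R]_k) : R := (x^T *m Q *m x) 0 0.
Definition sqnorm k (x : 'cV[R]_k) : R := \sum_(a < k) x a 0 ^+ 2.

Definition orthogonal_projector k (P : 'M[R]_k) : Prop :=
  P^T = P /\ P *m P = P.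

(* Mathcomp's pinvmx is only a one-sided partial inverse; the Moore-Penrose
   pseudo-inverse is the unique solution of the four Penrose equations. *)
Definition penrose k l (A : 'M[R]_(k, l)) (X : 'M[R]_(l, k)) : Prop :=
  [/\ A *m X *m A = A, X *m A *m X = X,
      (A *m X)^T = A *m X & (X *m A)^T = X *m A].

Definition pinv k l (A : 'M[R]_(k, l)) : 'M[R]_(l, k) := xget 0 (penrose A).

Lemma penrose_uniq k l (A : 'M[R]_(k, l)) X Y :
  penrose A X -> penrose A Y -> X = Y.
Proof.
move=> [X1 X2 X3 X4] [Y1 Y2 Y3 Y4].
have AXY : A *m X = A *m Y.
  rewrite -X3 -[in LHS]Y1 -[A *m Y *m A *m X]mulmxA trmx_mul X3 Y3.
  by rewrite mulmxA X1.
have XAY : X *m A = Y *m A.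
  rewrite -X4 -[in LHS]Y1 -[A *m Y *m A]mulmxA mulmxA trmx_mul X4 Y4.
  by rewrite -mulmxA [A *m (X *m A)]mulmxA X1.
by rewrite -X2 XAY -mulmxA AXY mulmxA Y2.
Qed.

Lemma gram_unit k l (B : 'M[R]_(k, l)) : row_free B -> B *m B^T \in unitmx.
Proof.
move=> Bfree; rewrite -row_free_unit -kermx_eq0; apply/eqP/row_matrixP => i.
rewrite row0; set u := row i _.
have uBB : u *m (B *m B^T) = 0.
  by apply/sub_kermxP; rewrite row_sub.
have uB : u *m B = 0.
  have : (u *m B *m (u *m B)^T) 0 0 = 0.
    by rewrite trmx_mul -mulmxA [B *m _]mulmxA mulmxA mulmxA -[u *m B *m _]mulmxA
       uBB mul0mx mxE.
  rewrite mxE => /eqP; rewrite psumr_eq0; last first.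
    by move=> j _; rewrite [_^T _ _]mxE -expr2 sqr_ge0.
  move=> /allP h; apply/rowP => j; have := h j (mem_index_enum _).
  by rewrite [_^T _ _]mxE -expr2 sqrf_eq0 [RHS]mxE => /eqP.
by apply: (row_free_inj Bfree); rewrite uB mul0mx.
Qed.

Lemma pinvP k l (A : 'M[R]_(k, l)) : penrose A (pinv A).
Proof.
rewrite /pinv; apply: (@xgetPex _ 0 (penrose A)).
have [r [C [B [AE uB uC]]]] : exists r (C : 'M[R]_(k, r)) (B : 'M[R]_(r, l)),
    [/\ A = C *m B, B *m B^T \in unitmx & C^T *m C \in unitmx].
  exists (\rank A), (col_base A), (row_base A); split.
  - by rewrite mulmx_base.
  - by apply: gram_unit; exact: row_base_free.
  - rewrite -[X in _ *m X]trmxK; apply: gram_unit.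
    by rewrite /row_free mxrank_tr; exact: col_base_full.
set GB := invmx (B *m B^T); set GC := invmx (C^T *m C).
have BG : B *m B^T *m GB = 1%:M by rewrite mulmxV.
have GCC : GC *m (C^T *m C) = 1%:M by rewrite mulVmx.
have AX : A *m (B^T *m GB *m GC *m C^T) = C *m GC *m C^T.
  rewrite AE !mulmxA -[C *m B *m B^T]mulmxA -[C *m _ *m GB]mulmxA BG.
  by rewrite mulmx1.
have XA : B^T *m GB *m GC *m C^T *m A = B^T *m GB *m B.
  rewrite AE !mulmxA -[_ *m C^T *m C]mulmxA -[_ *m GC *m (C^T *m C)]mulmxA GCC.
  by rewrite mulmx1.
have GBt : GB^T = GB by rewrite /GB trmx_inv trmx_mul trmxK.
have GCt : GC^T = GC by rewrite /GC trmx_inv trmx_mul trmxK.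
exists (B^T *m GB *m GC *m C^T); split.
- rewrite AX [in LHS]AE !mulmxA -[_ *m C^T *m C]mulmxA -[C *m GC *m _]mulmxA GCC.
  by rewrite mulmx1 -AE.
- rewrite XA !mulmxA -[_ *m B *m B^T]mulmxA -[_ *m (B *m B^T) *m GB]mulmxA BG.
  by rewrite mulmx1.
- by rewrite AX !trmx_mul trmxK GCt mulmxA.
- by rewrite XA !trmx_mul trmxK GBt mulmxA.
Qed.

(* Only applied to symmetric matrices. The sets are finite, so inf and sup are
   attained unless the set is empty, in which case the value is 0. *)
Definition lambda_min_pos k (M : 'M[R]_k) : R :=
  inf [set a | eigenvalue M a /\ a != 0].
Definition lambda_max k (M : 'M[R]_k) : R := sup [set a | eigenvalue M a].

End LinearAlgebra.

Section ConvexAnalysis.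
Context {R : realType} {d : nat}.
Implicit Types (f : 'cV[R]_d -> R) (g : 'cV[R]_d -> \bar R) (x y v : 'cV[R]_d).

Definition gradient f y : 'cV[R]_d := \col_(a < d) 'D_(delta_mx a 0) f y.

Definition smooth_wrt (P : 'M[R]_d) (L : R) f : Prop :=
  (forall y, differentiable f y) /\
  (forall x y,
     f x - f y <= ((gradient f y)^T *m P *m (x - y)) 0 0 + L / 2 * qform P (x - y)).

Definition fenchel f x : \bar R :=
  ereal_sup [set ((x^T *m y) 0 0 - f y)%:E | y in [set: 'cV[R]_d]].

Definition is_prox (h : R) g x v : Prop := forall w,
  (((2 * h)^-1 * sqnorm (v - x))%:E + g v <=
   ((2 * h)^-1 * sqnorm (w - x))%:E + g w)%E.

Definition prox (h : R) g x : 'cV[R]_d := xget 0 [set v | is_prox h g x v].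

End ConvexAnalysis.

Section BlockVectors.
Context {R : realType} {T : finType} {d : nat}.

Definition unit_vec (k : T) : 'cV[R]_#|T| := delta_mx (enum_rank k) 0.

(* Block structure of R^(#|T| d), compatible with the Kronecker product *t. *)
Definition blk (x : 'cV[R]_(#|T| * d)) (k : T) : 'cV[R]_d :=
  \col_a x (mxtens_index (enum_rank k, a)) 0.
Definition of_blk (x : T -> 'cV[R]_d) : 'cV[R]_(#|T| * d) :=
  \sum_(k : T) (unit_vec k *t x k).

Lemma of_blkK x k : blk (of_blk x) k = x k.
Proof.
apply/colP => a; rewrite !mxE summxE (bigD1 k) //= big1 => [|l lk].
  by rewrite !mxE mxtens_indexK /= !ord1 !eqxx mul1r addr0.
rewrite !mxE mxtens_indexK /= (inj_eq enum_rank_inj) eq_sym (negbTE lk).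
by rewrite mul0r.
Qed.

End BlockVectors.

(* Nodes are [inl i] (communication) and [inr (i, j)] (virtual); edges are
   [inl c] (communication, c < E) and [inr (i, j)] (virtual). *)
Notation node n m := ('I_n + 'I_n * 'I_m)%type.
Notation edge n m E := ('I_E + 'I_n * 'I_m)%type.

Notation nodevec R n m d := 'cV[R]_(#|{: node n m}| * d).
Notation edgevec R n m d E := 'cV[R]_(#|{: edge n m E}| * d).

(* Each communication edge c carries an arbitrary orientation
   (comm_src c, comm_tgt c). *)
Record adfs_data (R : realType) (n m d E : nat) := AdfsData {
  comm_src : 'I_E -> 'I_n;
  comm_tgt : 'I_E -> 'I_n;
  fij : 'I_n -> 'I_m -> 'cV[R]_d -> R;
  sigmai : 'I_n -> R;
  Lij : 'I_n -> 'I_m -> R;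
  Pij : 'I_n -> 'I_m -> 'M[R]_d;
  weight : edge n m E -> R;
  block_prob : {set edge n m E} -> R }.

Section Adfs.
Context {R : realType} {n m d E : nat} (D : adfs_data R n m d E).

Local Notation node := (node n m).
Local Notation edge := (edge n m E).
Local Notation block := {set edge}.
Local Notation nodevec := (nodevec R n m d).
Local Notation edgevec := (edgevec R n m d E).

Definition edge_src (e : edge) : node :=
  match e with inl c => inl (comm_src D c) | inr ij => inl ij.1 end.
Definition edge_tgt (e : edge) : node :=
  match e with inl c => inl (comm_tgt D c) | inr ij => inr ij end.
Definition eproj (e : edge) : 'M[R]_d :=
  match e with inl _ => 1%:M | inr ij => Pij D ij.1 ij.2 end.

Definition comm_edges : block := [set e | if e is inl _ then true else false].
Definition virtual_edges : block := [set e | if e is inr _ then true else false].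

Definition edge_prob (e : edge) : R := \sum_(b : block | e \in b) block_prob D b.

Definition comm_adj : rel 'I_n := fun i k =>
  [exists c, ((comm_src D c == i) && (comm_tgt D c == k)) ||
             ((comm_src D c == k) && (comm_tgt D c == i))].

Record adfs_assumptions : Prop := AdfsAssumptions {
  comm_noloop : forall c, comm_src D c != comm_tgt D c;
  comm_simple : forall c c',
    (comm_src D c, comm_tgt D c) = (comm_src D c', comm_tgt D c') \/
    (comm_src D c, comm_tgt D c) = (comm_tgt D c', comm_src D c') -> c = c';
  comm_connected : forall i k, connect comm_adj i k;
  sigmai_gt0 : forall i, 0 < sigmai D i;
  Lij_gt0 : forall i j, 0 < Lij D i j;
  Pij_proj : forall i j, orthogonal_projector (Pij D i j);
  fij_convex : forall i j, convex_function [set: 'cV[R]_d] (fij D i j);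
  fij_smooth : forall i j, smooth_wrt (Pij D i j) (Lij D i j) (fij D i j);
  weight_gt0 : forall e, 0 < weight D e;
  block_prob_ge0 : forall b, 0 <= block_prob D b;
  block_prob_sum1 : \sum_(b : block) block_prob D b = 1;
  block_prob_pure : forall b, 0 < block_prob D b ->
    (b \subset comm_edges) || (b \subset virtual_edges);
  edge_prob_gt0 : forall e, 0 < edge_prob e }.

Definition fi (i : 'I_n) (theta : 'cV[R]_d) : R :=
  \sum_(j < m) fij D i j theta + sigmai D i / 2 * sqnorm theta.
Definition primal_obj (theta : 'cV[R]_d) : R := \sum_(i < n) fi i theta.

Definition Amx : 'M[R]_(#|{: node}| * d, #|{: edge}| * d) :=
  \sum_(e : edge)
    weight D e *: (((unit_vec (edge_src e) - unit_vec (edge_tgt e)) *m (unit_vec e)^T)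
               *t eproj e).

Lemma AmxE (e : edge) (x : 'cV[R]_d) :
  Amx *m (unit_vec e *t x) =
  weight D e *: ((unit_vec (edge_src e) - unit_vec (edge_tgt e)) *t (eproj e *m x)).
Proof.
have uv e' : (unit_vec e')^T *m unit_vec e = (e' == e)%:R%:M :> 'M[R]_1.
  rewrite /unit_vec trmx_delta; apply/matrixP => i j; rewrite !ord1 !mxE.
  rewrite (bigD1 (enum_rank e)) //= big1 => [|k /negbTE ke]; last first.
    by rewrite !mxE ke mulr0.
  by rewrite !mxE !eqxx addr0 mulr1 (inj_eq enum_rank_inj) eq_sym.
have AE e' : (((unit_vec (edge_src e') - unit_vec (edge_tgt e')) *m (unit_vec e')^T)
    *t eproj e') *m (unit_vec e *t x) =
    (e' == e)%:R *: ((unit_vec (edge_src e') - unit_vec (edge_tgt e')) *t (eproj e' *m x)).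
  rewrite tensmx_mul -mulmxA uv mul_mx_scalar.
  by apply/matrixP => i j; rewrite !mxE mulrA.
rewrite mulmx_suml (bigD1 e) //= big1 ?addr0 => [|e' /negbTE e'e].
  by rewrite -scalemxAl AE eqxx scale1r.
by rewrite -scalemxAl AE e'e scale0r scaler0.
Qed.

Definition Sigma : 'M[R]_(#|{: node}| * d) :=
  \sum_(k : node)
    (unit_vec k *m (unit_vec k)^T) *t
    (match k with
     | inl i => (sigmai D i)%:M
     | inr ij => Lij D ij.1 ij.2 *: Pij D ij.1 ij.2
     end).

Definition GA : 'M[R]_(#|{: edge}| * d) := Amx^T *m pinv Sigma *m Amx.
Definition sigmaA : R := lambda_min_pos GA.

Definition fenchel_t (i : 'I_n) (j : 'I_m) (x : 'cV[R]_d) : \bar R :=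
  (fenchel (fij D i j) x - ((2 * Lij D i j)^-1 * qform (Pij D i j) x)%:E)%E.
Definition psi_ij (i : 'I_n) (j : 'I_m) (x : 'cV[R]_d) : \bar R :=
  fenchel_t i j (- (weight D (inr (i, j)) *: x)).
Definition psi (lam : edgevec) : \bar R :=
  (\sum_(i < n) \sum_(j < m) psi_ij i j (blk lam (inr (i, j))))%E.
Definition qA (lam : edgevec) : R := 2^-1 * qform GA lam.
Definition dual_obj (lam : edgevec) : \bar R := ((qA lam)%:E + psi lam)%E.

Definition Pb (b : block) : 'M[R]_(#|{: edge}| * d) :=
  diag_mx (\row_r (let e := enum_val r in if e \in b then edge_prob e else 0))
  *t 1%:M.
Definition Wb (b : block) := Amx *m pinv (Pb b) *m Amx^T.
Definition Wtb (b : block) := Amx *m pinv (Pb b) *m pinv Amx.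

(* The quotient is taken in \bar R, where inverting 0 gives +oo: a block on which
   the denominator vanishes does not constrain rho. *)
Definition step_bound (b : block) : \bar R :=
  (sigmaA%:E /
   (lambda_max (pinv Amx *m Amx *m pinv (Pb b) *m Amx^T *m pinv Sigma *m
                Amx *m pinv (Pb b) *m pinv Amx *m Amx))%:E)%E.

Section Algorithm.
Variable rho : R.

Definition stepsize : R := rho / sigmaA.

Definition adfs_y (x v : nodevec) : nodevec := (1 + rho)^-1 *: (x + rho *: v).

Definition adfs_z (b : block) (v y : nodevec) : nodevec :=
  (1 - rho) *: v + rho *: y - stepsize *: (Wb b *m pinv Sigma *m y).

Definition prox_edge (i : 'I_n) (j : 'I_m) (z : 'cV[R]_d) : 'cV[R]_d :=
  prox (stepsize * weight D (inr (i, j)) ^+ 2 * (edge_prob (inr (i, j)))^-1)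
       (fenchel_t i j) z.

Definition adfs_v (b : block) (z : nodevec) : nodevec :=
  if b \subset virtual_edges then
    let v_virt i j := if inr (i, j) \in b
                      then prox_edge i j (blk z (inr (i, j)))
                      else blk z (inr (i, j)) in
    of_blk (fun k : node => match k with
      | inr ij => v_virt ij.1 ij.2
      | inl i => blk z (inl i) +
          \sum_(j < m | inr (i, j) \in b) (blk z (inr (i, j)) - v_virt i j)
      end)
  else z.

Definition adfs_x (b : block) (v y v' : nodevec) : nodevec :=
  y + rho *: (Wtb b *m (v' - (1 - rho) *: v - rho *: y)).

Definition adfs_step (b : block) (xv : nodevec * nodevec) : nodevec * nodevec :=
  let: (x, v) := xv in
  let y := adfs_y x v in
  let z := adfs_z b v y in
  let v' := adfs_v b z in
  (adfs_x b v y v', v').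

(* The pair (x_t, v_t) when block [bs s] is drawn at iteration s. *)
Fixpoint adfs_iter (bs : nat -> block) (t : nat) : nodevec * nodevec :=
  if t is s.+1 then adfs_step (bs s) (adfs_iter bs s) else (0, 0).

Definition theta_out (bs : nat -> block) (t : nat) : nodevec :=
  pinv Sigma *m (adfs_iter bs t).2.

End Algorithm.

(* Takes the value +oo when dual_obj 0 = +oo (some f_ij unbounded below). *)
Definition C0 (thetaA : edgevec) : \bar R :=
  ((lambda_max (Amx^T *m (pinv Sigma *m pinv Sigma) *m Amx))%:E *
   ((sqnorm (pinv Amx *m Amx *m thetaA))%:E +
    (2 * sigmaA^-1)%:E * (dual_obj 0 - dual_obj thetaA)))%E.

Record iid_blocks {disp : measure_display} {Omega : measurableType disp}
    (Pr : probability Omega R) (B : nat -> Omega -> block) : Prop := IidBlocks {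
  block_measurable : forall s (C : set block), measurable (B s @^-1` C);
  block_law : forall s (b : block), Pr (B s @^-1` [set b]) = (block_prob D b)%:E;
  block_indep : forall (S : seq nat) (C : nat -> set block), uniq S ->
    Pr (\bigcap_(s in [set` S]) (B s @^-1` C s)) =
    (\prod_(s <- S) Pr (B s @^-1` C s))%E }.

End Adfs.

(* Main.v *)
(* The algorithm is the image under A of accelerated proximal coordinate descent
   on the dual: its node vectors are A x, A v with x, v edge vectors. Let Pi = A^+ A,
   fix a dual minimizer l and put |z|^2_Pi = <z, Pi z>. Taking the mean over the block, the potential
   q_A(x) + s + sigma_A/2 |v - l|^2_Pi - F*(l) contracts by 1 - rho, where the
   number s upper-bounds psi(x) and follows the same affine recursion as x.
   The bound s >= psi(x) holds because, on each virtual edge of probability p,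
   x = (rho/p) v + (1 - rho/p) u with an auxiliary point u whose recursion does not
   depend on the sampled block. The step bound on rho gives rho <= p on these edges
   and rho <= 1. Finally (Sigma^+ A l)_i is the primal minimizer at every node i, by
   the optimality conditions of the dual.
   The constant may be infinite (F*(0) = +oo): the claim is then trivial unless
   rho = 1, and in that case one step already reaches the domain of psi. *)
Require Import Defs.
From HB Require Import structures.
From mathcomp Require Import all_boot all_order all_algebra.
From mathcomp Require Import all_classical all_reals all_analysis.
From mathcomp Require Import ring lra measurable_realfun.

Set Implicit Arguments.
Unset Strict Implicit.
Unset Printing Implicit Defensive.

Import Order.TTheory GRing.Theory Num.Theory.
Import numFieldNormedType.Exports.
Local Open Scope classical_set_scope.
Local Open Scope ring_scope.

(* [pinv] also names a partial inverse of functions in mathcomp.classical. *)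
Local Notation pinv := Defs.pinv.

(** * Euclidean inner product and extremal eigenvalues *)

Section Dot.
Context {R : realType}.

(** The obstacle is that [Pi] couples edges while the proximal step is separable. It is harmless
    because a virtual node is a leaf: on the virtual edge (i, j), [Pi] acts as [Pij D i j] alone,
    and [psi] is finite only where the virtual blocks lie in the ranges of these projectors. On
    communication edges [Pi] does couple blocks, but [psi] is absent there, and a sampled block
    never mixes the two kinds. The contraction needs no finiteness of [psi] at the iterates: it is
    an inequality between real numbers carried by the state, whatever their initial values. Only the
    lower bound of the potential by F*(l) uses that these numbers majorise [psi]. This separation is
    what makes an infinite F*(0) tractable when rho = 1. *)

Definition dot k (x y : 'cV[R]_k) : R := (x^T *m y) 0 0.

Lemma dotE k (x y : 'cV[R]_k) : dot x y = \sum_a x a 0 * y a 0.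
Proof. by rewrite /dot mxE; apply: eq_bigr => a _; rewrite mxE. Qed.

Lemma dotC k (x y : 'cV[R]_k) : dot x y = dot y x.
Proof. by rewrite !dotE; apply: eq_bigr => a _; rewrite mulrC. Qed.

Lemma dotDr k (x y z : 'cV[R]_k) : dot x (y + z) = dot x y + dot x z.
Proof. by rewrite /dot mulmxDr mxE. Qed.

Lemma dotDl k (x y z : 'cV[R]_k) : dot (x + y) z = dot x z + dot y z.
Proof. by rewrite dotC dotDr !(dotC z). Qed.

Lemma dotZr k c (x y : 'cV[R]_k) : dot x (c *: y) = c * dot x y.
Proof. by rewrite /dot -scalemxAr mxE. Qed.

Lemma dotZl k c (x y : 'cV[R]_k) : dot (c *: x) y = c * dot x y.
Proof. by rewrite dotC dotZr dotC. Qed.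

Lemma dotNr k (x y : 'cV[R]_k) : dot x (- y) = - dot x y.
Proof. by rewrite -scaleN1r dotZr mulN1r. Qed.

Lemma dotNl k (x y : 'cV[R]_k) : dot (- x) y = - dot x y.
Proof. by rewrite dotC dotNr dotC. Qed.

Lemma dot0r k (x : 'cV[R]_k) : dot x 0 = 0.
Proof. by rewrite /dot mulmx0 mxE. Qed.

Lemma dot0l k (x : 'cV[R]_k) : dot 0 x = 0.
Proof. by rewrite dotC dot0r. Qed.

Definition dotL := (@dotDr, @dotDl, @dotNr, @dotNl, @dotZr, @dotZl, @dot0r, @dot0l).

Lemma dot_suml k (I : Type) (r : seq I) (Q : pred I) (F : I -> 'cV[R]_k) x :
  dot (\sum_(i <- r | Q i) F i) x = \sum_(i <- r | Q i) dot (F i) x.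
Proof.
exact: (big_morph (fun y => dot y x) (fun y z => dotDl y z x) (dot0l x)).
Qed.

Lemma dot_mul k l (A : 'M[R]_(k, l)) x y : dot (A *m x) y = dot x (A^T *m y).
Proof. by rewrite /dot trmx_mul mulmxA. Qed.

Lemma dot_mulr k l (A : 'M[R]_(k, l)) x y : dot x (A *m y) = dot (A^T *m x) y.
Proof. by rewrite dot_mul trmxK. Qed.

Lemma dot_ge0 k (x : 'cV[R]_k) : 0 <= dot x x.
Proof. by rewrite dotE sumr_ge0// => a _; rewrite -expr2 sqr_ge0. Qed.

Lemma dot_eq0 k (x : 'cV[R]_k) : dot x x = 0 -> x = 0.
Proof.
rewrite dotE => /eqP; rewrite psumr_eq0; last by move=> a _; rewrite -expr2 sqr_ge0.
move=> /allP h; apply/colP => a; have := h a (mem_index_enum _).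
by rewrite mxE -expr2 sqrf_eq0 => /eqP.
Qed.

Lemma dot_gt0 k (x : 'cV[R]_k) : x != 0 -> 0 < dot x x.
Proof.
move=> x0; rewrite lt_neqAle dot_ge0 andbT eq_sym.
by apply: contra_neq x0 => /dot_eq0.
Qed.

Lemma dot_inj k (x y : 'cV[R]_k) : (forall z, dot x z = dot y z) -> x = y.
Proof.
move=> h; apply/eqP; rewrite -subr_eq0; apply/eqP/dot_eq0.
by rewrite dotDl dotNl h subrr.
Qed.

Lemma sqnormE k (x : 'cV[R]_k) : sqnorm x = dot x x.
Proof. by rewrite dotE /sqnorm; apply: eq_bigr => a _; rewrite expr2. Qed.

Lemma qformE k (Q : 'M[R]_k) x : qform Q x = dot x (Q *m x).
Proof. by rewrite /qform /dot mulmxA. Qed.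

Lemma proj_dot k (P : 'M[R]_k) x y : orthogonal_projector P ->
  dot (P *m x) (P *m y) = dot x (P *m y).
Proof. by move=> [Pt PP]; rewrite dot_mul Pt mulmxA PP. Qed.

Lemma proj_dotC k (P : 'M[R]_k) x y : orthogonal_projector P ->
  dot (P *m x) y = dot x (P *m y).
Proof. by move=> [Pt PP]; rewrite dot_mul Pt. Qed.

Lemma coord_le_dot k (x : 'cV[R]_k) a : `|x a 0| <= 1 + dot x x.
Proof.
have h : x a 0 ^+ 2 <= dot x x.
  rewrite dotE (bigD1 a)//= expr2 lerDl sumr_ge0// => b _.
  by rewrite -expr2 sqr_ge0.
have : `|x a 0| ^+ 2 <= dot x x by rewrite real_normK ?num_real.
by have := normr_ge0 (x a 0); nra.
Qed.

(** Moving from u by -s T u changes the form by -2s|T u|^2 + s^2 c, which is negative for small s >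
    0 unless T u = 0. *)
Lemma psd_kernel k (T : 'M[R]_k) u : T^T = T ->
  (forall x, 0 <= dot x (T *m x)) -> dot u (T *m u) = 0 -> T *m u = 0.
Proof.
move=> Tt Tpos u0; apply: dot_eq0.
set v := T *m u; have vu : dot v v = dot u (T *m v) by rewrite [RHS]dot_mulr Tt.
have := Tpos v; set c := dot v (T *m v) => c0.
have h s : 0 <= - 2 * s * dot v v + s ^+ 2 * c.
  have := Tpos (u - s *: v); rewrite mulmxBr -scalemxAr -/v !dotL -/c -vu u0.
  by move=> h; lra.
have vv := dot_ge0 v.
apply/eqP; rewrite eq_le vv andbT leNgt; apply/negP => vp.
have c1 : 0 < c + 1 by lra.
have := h (dot v v / (c + 1)); set s := dot v v / _.
have sE : s * (c + 1) = dot v v by rewrite /s mulfVK// gt_eqF.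
have s0 : 0 < s by rewrite divr_gt0.
by rewrite -sE; nra.
Qed.

Lemma continuous_sumr (T : topologicalType) (I : Type) (r : seq I) (f : I -> T -> R) :
  (forall i, continuous (f i)) -> continuous (fun x => \sum_(i <- r) f i x).
Proof.
move=> cf; elim: r => [|i r IH] x.
  by under eq_fun do rewrite big_nil; exact: cvg_cst.
under eq_fun do rewrite big_cons.
by apply: cvgD; [exact: cf|exact: IH].
Qed.

Lemma continuous_addr (T : topologicalType) (f g : T -> R) :
  continuous f -> continuous g -> continuous (fun x => f x + g x).
Proof. by move=> cf cg x; apply: cvgD; [exact: cf|exact: cg]. Qed.

Lemma continuous_mulr (T : topologicalType) (f g : T -> R) :
  continuous f -> continuous g -> continuous (fun x => f x * g x).
Proof. by move=> cf cg x; apply: cvgM; [exact: cf|exact: cg]. Qed.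

Lemma continuous_dot (T : topologicalType) k (f g : T -> 'cV[R]_k) :
  (forall a, continuous (fun r => f r a 0)) ->
  (forall a, continuous (fun r => g r a 0)) ->
  continuous (fun r => dot (f r) (g r)).
Proof.
move=> cf cg; under eq_fun do rewrite dotE.
by apply: continuous_sumr => a; apply: continuous_mulr.
Qed.

Lemma continuous_mul_tr k l (S : 'M[R]_(l, k)) a :
  continuous (fun r : 'rV[R]_k => (S *m r^T) a 0).
Proof.
under eq_fun do rewrite mxE; apply: continuous_sumr => b.
apply: continuous_mulr; first exact: cst_continuous.
by under eq_fun do rewrite mxE; exact: coord_continuous.
Qed.

Lemma continuous_tr k (a : 'I_k) : continuous (fun r : 'rV[R]_k => r^T a 0).
Proof. by under eq_fun do rewrite -[_^T]mul1mx; exact: continuous_mul_tr. Qed.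

(** Maximises the Rayleigh quotient on the unit sphere of the range of P. With P = 1 it yields the
    largest eigenvalue; applied to -S with P the projector onto the range of S, the smallest nonzero
    one. *)
Lemma rayleigh_max k (S P : 'M[R]_k) : S^T = S -> orthogonal_projector P ->
    P *m S = S *m P -> P != 0 ->
  exists (u : 'cV[R]_k) t, [/\ u != 0, P *m u = u, S *m u = t *: u &
    forall x : 'cV[R]_k, P *m x = x -> dot x (S *m x) <= t * dot x x].
Proof.
move=> St hP PS P0; have [Pt PP] := hP.
pose K := [set r : 'rV[R]_k | P *m r^T = r^T /\ dot r^T r^T = 1].
have [x0 [Px0 x00]] : exists x0 : 'cV[R]_k, P *m x0 = x0 /\ x0 != 0.
  have /matrix0Pn [a [b ab]] := P0.
  exists (P *m delta_mx b 0); split; first by rewrite mulmxA PP.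
  apply: contra_neq ab => /colP/(_ a); rewrite !mxE (bigD1 b)//= big1.
    by rewrite !mxE !eqxx mulr1 addr0.
  by move=> c cb; rewrite mxE (negbTE cb) mulr0.
have nrm (x : 'cV[R]_k) : x != 0 -> exists2 c, 0 < c & c ^+ 2 * dot x x = 1.
  move=> /dot_gt0 x1; exists (Num.sqrt (dot x x)^-1).
    by rewrite sqrtr_gt0 invr_gt0.
  by rewrite sqr_sqrtr ?invr_ge0 ?ltW// mulVf// gt_eqF.
have K0 : K !=set0.
  have [c c0 cx] := nrm _ x00; exists (c *: x0)^T; rewrite /K /= trmxK; split.
    by rewrite -scalemxAr Px0.
  by rewrite !dotL -cx; ring.
have cK : compact K.
  apply: bounded_closed_compact.
    exists 2; split=> // M M2 r [_ r1] /=.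
    rewrite [leLHS]/Num.norm /= mx_normrE.
    apply/bigmax_leP; split=> [|[i a] _ /=]; first by lra.
    have := coord_le_dot r^T a; rewrite r1 mxE (ord1 i); lra.
  rewrite (_ : K = (fun r : 'rV[R]_k => dot (r^T - P *m r^T) (r^T - P *m r^T)) @^-1` [set 0]
     `&` (fun r : 'rV[R]_k => dot r^T r^T) @^-1` [set 1]); last first.
    apply/seteqP; split=> r /=; first by move=> [-> ->]; rewrite subrr dot0r.
    by move=> [/dot_eq0/eqP h h1]; split=> //; move: h; rewrite subr_eq0 eq_sym => /eqP.
  have cP a : continuous (fun r : 'rV[R]_k => (r^T - P *m r^T) a 0).
    under eq_fun do rewrite -[X in X - _]mul1mx -mulmxBl.
    exact: continuous_mul_tr.
  by apply: closedI; apply: preimage_closed; try exact: closed_eq;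
    move=> r _; apply: continuous_dot => // a; exact: continuous_tr.
have cf : {within K, continuous (fun r : 'rV[R]_k => dot r^T (S *m r^T))}.
  apply: continuous_subspaceT; apply: continuous_dot => a.
    exact: continuous_tr.
  exact: continuous_mul_tr.
have [r /set_mem [Pr r1] rmax] := EVT_max_rV K0 cK cf.
set u := r^T in Pr r1 rmax; set t := dot u (S *m u) in rmax.
have u0 : u != 0.
  by apply/eqP => u0; move: r1; rewrite u0 dot0r => /eqP; rewrite eq_sym oner_eq0.
have bnd x : P *m x = x -> dot x (S *m x) <= t * dot x x.
  move=> Px; have [->|x1] := eqVneq x 0; first by rewrite mulmx0 !dot0r mulr0.
  have [c c0 cx] := nrm _ x1.
  have : (c *: x)^T \in K by apply/mem_set; rewrite /K/= trmxK -scalemxAr Px !dotL -cx; split=> //; ring.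
  move=> /rmax; rewrite trmxK -scalemxAr !dotL => h.
  rewrite -(ler_pM2l (exprn_gt0 2 c0)) [X in _ <= X]mulrCA cx mulr1.
  by rewrite expr2 -mulrA.
exists u, t; split=> //.
(* In place of a multiplier argument: the form of this matrix is nonnegative by [bnd] and vanishes
   at u, so u lies in its kernel. *)
have : (t *: P - S *m P) *m u = 0.
  apply: psd_kernel.
  - by rewrite linearB linearZ /= trmx_mul St Pt PS.
  - move=> x; have := bnd (P *m x); rewrite mulmxA PP => /(_ erefl).
    have PSP : P *m (S *m (P *m x)) = S *m P *m x.
      by rewrite !mulmxA PS -(mulmxA S P P) PP.
    by rewrite mulmxBl -scalemxAl !dotL proj_dot// proj_dotC// PSP; lra.
  - by rewrite mulmxBl -scalemxAl -mulmxA Pr !dotL r1 -/t mulr1 subrr.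
by rewrite mulmxBl -scalemxAl -mulmxA Pr => /eqP; rewrite subr_eq0 => /eqP.
Qed.


Lemma eigenvalue_sym k (S : 'M[R]_k) a : S^T = S ->
  eigenvalue S a <-> exists2 u : 'cV[R]_k, u != 0 & S *m u = a *: u.
Proof.
move=> St; split=> [/eigenvalueP[v vS v0]|[u u0 Su]].
  exists v^T; first by rewrite -(inj_eq trmx_inj) trmxK trmx0.
  by rewrite -[X in X *m _]St -trmx_mul vS linearZ.
apply/eigenvalueP; exists u^T.
  by rewrite -[X in _ *m X]St -trmx_mul Su linearZ.
by rewrite -(inj_eq trmx_inj) trmxK trmx0.
Qed.

Lemma projector1 k : orthogonal_projector (1%:M : 'M[R]_k).
Proof. by split; rewrite ?trmx1 ?mulmx1. Qed.

Lemma lambda_max_ub k (S : 'M[R]_k) x : S^T = S ->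
  dot x (S *m x) <= lambda_max S * dot x x.
Proof.
case: k S x => [|k] S x St; first by rewrite (flatmx0 x) mulmx0 dot0r mulr0.
have [||u [t [u0 _ Su bnd]]] := rayleigh_max St (projector1 _).
- by rewrite mul1mx mulmx1.
- exact: oner_neq0.
suff <- : t = lambda_max S by apply: bnd; rewrite mul1mx.
have St' : [set a | eigenvalue S a] t by apply/(eigenvalue_sym _ St); exists u.
have ub : ubound [set a | eigenvalue S a] t.
  move=> a /(eigenvalue_sym _ St)[v v0 Sv].
  have := bnd v; rewrite mul1mx => /(_ erefl).
  by rewrite Sv dotZr ler_pM2r// dot_gt0.
apply/eqP; rewrite eq_le sup_upper_bound//=; last first.
  by split; [exists t|exists t].
by apply: ge_sup => //; exists t.
Qed.

(** The kernel hypothesis makes the minimum of the form on the unit sphere of the range of P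
    positive. Eigenvectors of nonzero eigenvalues lie in that range because P S = S, so none of
    these eigenvalues is smaller. *)
Lemma lambda_min_pos_gt0_le k (S P : 'M[R]_k) :
    S^T = S -> (forall x : 'cV[R]_k, 0 <= dot x (S *m x)) ->
    orthogonal_projector P -> S *m P = S -> (forall x : 'cV[R]_k, S *m x = 0 -> P *m x = 0) ->
    P != 0 ->
  0 < lambda_min_pos S /\
  forall x : 'cV[R]_k, lambda_min_pos S * dot x (P *m x) <= dot x (S *m x).
Proof.
move=> St Spos hP SP kerS P0; have [Pt PP] := hP.
have PS : P *m S = S by have := congr1 trmx SP; rewrite trmx_mul Pt St.
have [||u [t [u0 Pu Su bnd]]] := @rayleigh_max k (- S) P _ hP _ P0.
- by rewrite linearN/= St.
- by rewrite mulmxN mulNmx PS SP.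
have Su' : S *m u = (- t) *: u by rewrite scaleNr -Su mulNmx opprK.
have lb x : - t * dot x (P *m x) <= dot x (S *m x).
  have := bnd (P *m x); rewrite mulmxA PP => /(_ erefl).
  rewrite mulNmx dotNr proj_dot// proj_dotC// !mulmxA PS SP; lra.
have t0 : 0 < - t.
  rewrite lt_neqAle; apply/andP; split.
    apply/eqP => t0; move/eqP: u0; apply; rewrite -Pu; apply: kerS.
    by rewrite Su' -t0 scale0r.
  by have := Spos u; rewrite Su' dotZr pmulr_lge0// dot_gt0.
suff -> : lambda_min_pos S = - t by split.
set T := [set a | eigenvalue S a /\ a != 0].
have Tt : T (- t).
  by split; [apply/(eigenvalue_sym _ St); exists u|rewrite gt_eqF].
have lbT : lbound T (- t).
  move=> a [/(eigenvalue_sym _ St)[v v0 Sv] a0].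
  have Pv : P *m v = v.
    have : P *m (S *m v) = S *m v by rewrite mulmxA PS.
    rewrite Sv -scalemxAr => /(congr1 (fun z => a^-1 *: z)).
    by rewrite !scalerA mulVf// !scale1r.
  by have := lb v; rewrite Pv Sv dotZr ler_pM2r// dot_gt0.
apply/eqP; rewrite eq_le ge_inf//=; last by exists (- t).
by apply: lb_le_inf => //; exists (- t).
Qed.

Lemma lambda_min_pos0 k : lambda_min_pos (0 : 'M[R]_k) = 0.
Proof.
rewrite /lambda_min_pos (_ : [set _ | _] = set0) ?inf0//.
apply/seteqP; split=> a //= [/eigenvalueP[v]].
by rewrite mulmx0 => /esym/eqP; rewrite scaler_eq0 => /orP[]/eqP->; rewrite eqxx.
Qed.

End Dot.

(** * Proximal points of suprema of affine functions *)

Section SupAffine.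
Context {R : realType} {d : nat} {I : Type} (i0 : I).
Variables (g : 'cV[R]_d -> \bar R) (a : I -> 'cV[R]_d) (b : I -> R).
(** Presents g as a supremum of affine functions, through its real upper bounds only. Convexity and
    closedness are then checked one affine function at a time, while g may take the value +oo. *)
Hypothesis g_le : forall u r, (g u <= r%:E)%E <-> forall i, dot (a i) u + b i <= r.

Lemma sup_affine_neqNy u : g u != -oo%E.
Proof.
apply/eqP => gu; have /g_le/(_ i0) : (g u <= (dot (a i0) u + b i0 - 1)%:E)%E.
  by rewrite gu leNye.
lra.
Qed.

Lemma sup_affine_fin u r : (g u <= r%:E)%E -> (fine (g u))%:E = g u.
Proof.
move=> gur; rewrite fineK// fin_numE sup_affine_neqNy/=.
by apply/eqP => gu; move: gur; rewrite gu leye_eq.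
Qed.

Lemma sup_affine_convex u1 u2 r1 r2 c1 c2 :
  (g u1 <= r1%:E)%E -> (g u2 <= r2%:E)%E -> 0 <= c1 -> 0 <= c2 -> c1 + c2 = 1 ->
  (g (c1 *: u1 + c2 *: u2)%R <= (c1 * r1 + c2 * r2)%:E)%E.
Proof.
move=> /g_le h1 /g_le h2 c10 c20 c12; apply/g_le => i; rewrite !dotL.
have -> : b i = c1 * b i + c2 * b i by rewrite -mulrDl c12 mul1r.
by have := ler_wpM2l c10 (h1 i); have := ler_wpM2l c20 (h2 i); lra.
Qed.

(** The sublevel sets [K e] of the proximal objective, e above its infimum, are nonempty, closed,
    bounded and nested, so they share a point. Boundedness comes from the single affine minorant of
    index [i0]. *)
Lemma is_prox_exists h z u0 s0 : 0 < h -> (g u0 <= s0%:E)%E ->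
  exists v, is_prox h g z v.
Proof.
move=> h0 gu0.
pose Sub r (w : 'cV[R]_d) :=
  forall i, (2 * h)^-1 * dot (w - z) (w - z) + (dot (a i) w + b i) <= r.
have SubE r w : Sub r w <-> (g w <= (r - (2 * h)^-1 * dot (w - z) (w - z))%:E)%E.
  by rewrite g_le; split=> H i; have := H i; lra.
(* The minimum over w of the quadratic plus the affine function of index [i0], reached at
   [z - h *: a i0]. *)
pose m := dot (a i0) z - h / 2 * dot (a i0) (a i0) + b i0.
have coer r w : Sub r w ->
    (2 * h)^-1 * dot (w - z + h *: a i0) (w - z + h *: a i0) <= r - m.
  move=> /(_ i0); rewrite lerBrDr /m !dotL (dotC _ z) (dotC _ w) (dotC (a i0) z) (dotC (a i0) w).
  apply: le_trans; rewrite le_eqVlt; apply/orP; left; apply/eqP.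
  by field; rewrite gt_eqF.
pose J := [set r | exists w, Sub r w].
have J0 : J !=set0.
  exists ((2 * h)^-1 * dot (u0 - z) (u0 - z) + s0), u0; apply/SubE.
  by rewrite addrC addKr.
have Jlb : has_lbound J.
  exists m => r [w /coer]; have := dot_ge0 (w - z + h *: a i0).
  set D := dot _ _ => D0; have : 0 <= (2 * h)^-1 * D by rewrite mulr_ge0// invr_ge0; lra.
  lra.
have Jinf : has_inf J by split.
pose r0 := inf J.
have le_r0 r w : Sub r w -> r0 <= r by move=> H; apply: ge_inf => //; exists w.
pose K e := [set x : 'rV[R]_d | Sub (r0 + e) x^T].
have Kne e : 0 < e -> K e !=set0.
  move=> e0; have [r [w Hw] rlt] := inf_adherent e0 Jinf.
  by exists w^T; rewrite /K/= trmxK => i; apply: le_trans (Hw i) (ltW rlt).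
have Kcl e : closed (K e).
  have -> : K e = \bigcap_(i in [set: I]) (fun x : 'rV[R]_d =>
      (2 * h)^-1 * dot (x^T - z) (x^T - z) + (dot (a i) x^T + b i)) @^-1` [set y | y <= r0 + e].
    by apply/seteqP; split=> x /= H i => [_|]; exact: H.
  apply: closed_bigI => i _; apply: preimage_closed; last exact: closed_le.
  have ct : continuous (fun x : 'rV[R]_d => dot (a i) x^T).
    apply: continuous_dot => c; first exact: cst_continuous.
    exact: continuous_tr.
  have cz c : continuous (fun x : 'rV[R]_d => (x^T - z) c 0).
    under eq_fun do rewrite mxE.
    by apply: continuous_addr; [exact: continuous_tr|exact: cst_continuous].
  move=> x _; apply: continuous_addr; last by apply: continuous_addr => //; exact: cst_continuous.
  by apply: continuous_mulr; [exact: cst_continuous|exact: continuous_dot].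
have Kbd e : bounded_set (K e).
  pose C := 2 * h * (r0 + e - m) + 1.
  pose q := z - h *: a i0.
  exists (C + (1 + dot q q)); split; first exact: num_real.
  move=> M CM x /coer; rewrite (_ : _ - z + _ = x^T - q) => [Hx|]; last by rewrite opprB addrCA addrC.
  rewrite /= [leLHS]/Num.norm /= mx_normrE.
  have Cx : 1 + dot (x^T - q) (x^T - q) <= C.
    move: Hx; rewrite mulrC ler_pdivrMr; last lra.
    rewrite /C; lra.
  have M0 : 0 <= M.
    by have := dot_ge0 (x^T - q); have := dot_ge0 q; lra.
  apply/bigmax_leP; split=> // [[k c] _ /=].
  have := coord_le_dot (x^T - q) c; have := coord_le_dot q c.
  have := ler_normD ((x^T - q) c 0) (q c 0).
  have -> : (x^T - q) c 0 + q c 0 = x k c by rewrite (ord1 k) !mxE subrK.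
  lra.
pose F := filter_from [set e : R | 0 < e] K.
have Kmono e e' w : e <= e' -> K e w -> K e' w.
  by move=> ee' H i; apply: le_trans (H i) _; lra.
have FF : ProperFilter F.
  apply: filter_from_proper; last by move=> e; exact: Kne.
  apply: filter_from_filter; first by exists 1; rewrite /=.
  move=> e e' /= e0 e'0; exists (Num.min e e'); first by rewrite /= lt_min e0.
  by move=> w Kw; split; apply: Kmono Kw; rewrite ge_min lexx ?orbT.
have [x [_ xcl]] : K 1 `&` cluster F !=set0.
  apply: (bounded_closed_compact (Kbd 1) (Kcl 1) FF).
  by exists 1 => //=.
have Kx e : 0 < e -> K e x.
  by move=> e0; apply: Kcl => U Ux; apply: xcl => //; exists e.
have Sx : Sub r0 x^T.
  by move=> i; apply/ler_addgt0Pr => e e0; exact: Kx.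
exists x^T => w; rewrite !sqnormE.
case gw : (g w) => [s| |]; last 2 first.
- by rewrite addey// leey.
- by have := sup_affine_neqNy w; rewrite gw.
have /le_r0 : Sub ((2 * h)^-1 * dot (w - z) (w - z) + s) w.
  by apply/SubE; rewrite addrC addKr gw.
move=> r0le; have /SubE gx := Sx.
rewrite -EFinD; apply: le_trans (_ : (r0%:E <= _)%E); last by rewrite lee_fin.
by rewrite addeC -leeBrDr// EFinN -EFinB; exact: gx.
Qed.

(** The optimality condition: (z - v) / h is a subgradient of g at the proximal point v. It follows
    by comparing v with s w + (1 - s) v and letting s tend to 0. *)
Lemma prox_le h z u0 s0 w r : 0 < h -> (g u0 <= s0%:E)%E -> (g w <= r%:E)%E ->
  (g (prox h g z) <=
   (r - h^-1 * dot (z - prox h g z) (w - prox h g z))%:E)%E.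
Proof.
move=> h0 gu0 gw; set v := prox h g z.
have vP : is_prox h g z v.
  by have [v' hv'] := is_prox_exists z h0 gu0; apply: (@xgetPex _ 0 [set v | is_prox h g z v]); exists v'.
have gvfin : (fine (g v))%:E = g v.
  have := vP u0; rewrite !sqnormE; case gv : (g v) => [s| |] //=.
    by rewrite addey// leye_eq => /eqP; case: (g u0) gu0 => //= s _.
  by have := sup_affine_neqNy v; rewrite gv.
set f := fine (g v) in gvfin; rewrite -gvfin lee_fin.
have gv : (g v <= f%:E)%E by rewrite gvfin.
have key s : 0 < s -> s <= 1 ->
    f + h^-1 * dot (z - v) (w - v) <= r + s * ((2 * h)^-1 * dot (w - v) (w - v)).
  move=> s0' s1.
  have := sup_affine_convex gw gv (ltW s0') (_ : 0 <= 1 - s) (_ : s + (1 - s) = 1).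
  move=> /(_ ltac:(lra) ltac:(ring)) gc.
  have := vP (s *: w + (1 - s) *: v); rewrite -gvfin !sqnormE => /le_trans.
  move=> /(_ _ (leeD2l _ gc)); rewrite -!EFinD lee_fin => H.
  rewrite -(ler_pM2l s0'); move: H.
  have -> : s *: w + (1 - s) *: v - z = (v - z) + s *: (w - v).
    by apply/colP => c; rewrite !mxE; ring.
  have -> : z - v = - (v - z) by rewrite opprB.
  move: (v - z) (w - v) => p q; rewrite !dotL (dotC q p).
  set pp := dot p p; set pq := dot p q; set qq := dot q q.
  have -> : h^-1 = 2 * (2 * h)^-1 by field; rewrite gt_eqF.
  set k := (2 * h)^-1 => H; nra.
rewrite lerBrDr; apply/ler_addgt0Pr => e e0.
set c := (2 * h)^-1 * dot (w - v) (w - v) in key.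
have c0 : 0 <= c by rewrite mulr_ge0 ?dot_ge0// invr_ge0; lra.
(* Small enough that s c <= e; dividing by c + 1 covers c = 0. *)
have sp : 0 < Num.min 1 (e / (c + 1)) by rewrite lt_min ltr01 divr_gt0//; lra.
apply: le_trans (key _ sp _) _; first by rewrite ge_min lexx.
rewrite lerD2l; apply: le_trans (_ : e / (c + 1) * c <= _).
  by rewrite ler_wpM2r// ge_min lexx orbT.
by rewrite mulrAC ler_pdivrMr; nra.
Qed.

End SupAffine.

(** * Conjugates of smooth convex functions *)

Section SmoothConjugate.
Context {R : realType} {d : nat}.
Variables (f : 'cV[R]_d -> R) (P : 'M[R]_d) (L : R).
Hypotheses (hP : orthogonal_projector P) (L0 : 0 < L).
Hypotheses (fconv : convex_function [set: 'cV[R]_d] f) (fsm : smooth_wrt P L f).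

(** The part of the gradient that the smoothness inequality sees; by [convex_lower] it is itself a
    subgradient of f. *)
Definition pgrad y := P *m gradient f y.

Definition smooth_conj (u : 'cV[R]_d) : \bar R :=
  (fenchel f u - ((2 * L)^-1 * qform P u)%:E)%E.

Lemma pgrad_proj y : P *m pgrad y = pgrad y.
Proof. by rewrite /pgrad mulmxA (proj2 hP). Qed.

Lemma smooth_upper x y :
  f x - f y <= dot (pgrad y) (x - y) + L / 2 * dot (x - y) (P *m (x - y)).
Proof.
have := (proj2 fsm) x y; rewrite qformE -mulmxA.
by rewrite -[((gradient f y)^T *m _) 0 0]/(dot _ _) -proj_dotC.
Qed.

Lemma convex_function_le t x y : 0 <= t -> t <= 1 ->
  f (t *: x + (1 - t) *: y) <= t * f x + (1 - t) * f y.
Proof.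
by move=> t0 t1; apply: (fconv (Itv01 t0 t1)); exact: mem_set.
Qed.

(* Smoothness bounds f at y - s (x - y) and convexity transfers the bound to x;
   dividing by s -> 0 gives the first-order condition without differentiating. *)
Lemma convex_lower x y : dot (pgrad y) (x - y) <= f x - f y.
Proof.
set c := L / 2 * dot (x - y) (P *m (x - y)).
have c0 : 0 <= c.
  rewrite mulr_ge0//; first by rewrite divr_ge0// ltW.
  by rewrite -proj_dot// dot_ge0.
have key s : 0 < s -> dot (pgrad y) (x - y) <= f x - f y + s * c.
  move=> s0; have := smooth_upper (y - s *: (x - y)) y.
  rewrite [y - _]addrC addrK mulmxN -scalemxAr !(dotNr, dotNl, dotZr, dotZl) opprK.
  have t0 : 0 <= (1 + s)^-1 by rewrite invr_ge0; lra.
  have t1 : (1 + s)^-1 <= 1 by rewrite invf_le1; lra.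
  have := convex_function_le (- (s *: (x - y)) + y) x t0 t1.
  have -> : (1 + s)^-1 *: (- (s *: (x - y)) + y) + (1 - (1 + s)^-1) *: x = y.
    by apply/colP => i; rewrite !mxE; field; lra.
  move=> h1 h2.
  have h3 : (1 + s) * f y <= f (- (s *: (x - y)) + y) + s * f x.
    rewrite -(ler_pM2l (_ : 0 < (1 + s)^-1)) ?invr_gt0; last lra.
    rewrite mulrA mulVf ?mul1r; last lra.
    apply: le_trans h1 _; rewrite le_eqVlt; apply/orP; left; apply/eqP; field; lra.
  rewrite -(ler_pM2l s0); move: h2; rewrite /c.
  set D := dot (x - y) _ => h2; nra.
apply/ler_addgt0Pr => e e0.
have sp : 0 < e / (c + 1) by rewrite divr_gt0//; lra.
apply: le_trans (key _ sp) _; rewrite lerD2l.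
by rewrite mulrAC ler_pdivrMr; nra.
Qed.

Lemma smooth_conj_le u r : (smooth_conj u <= r%:E)%E <->
  forall y, dot u y - f y - (2 * L)^-1 * dot u (P *m u) <= r.
Proof.
rewrite /smooth_conj leeBlDr// -EFinD /fenchel qformE; split=> [h y|h].
  rewrite lerBlDr -lee_fin; apply: le_trans h.
  by apply: ereal_sup_ubound; exists y.
apply: ge_ereal_sup => _ [y _ <-]; rewrite lee_fin -lerBlDr; exact: h.
Qed.

(* Subtracting the quadratic from the conjugate of a smooth function leaves a
   supremum of affine functions: this is the strong convexity of the conjugate. *)
Lemma smooth_conj_affine u r : (smooth_conj u <= r%:E)%E <->
  forall y, dot (y - L^-1 *: pgrad y) u +
    ((2 * L)^-1 * dot (pgrad y) (pgrad y) - f y) <= r.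
Proof.
rewrite smooth_conj_le; split=> h y.
  (* Over displacements in the range of P, this test point maximises dot u x minus the quadratic
     upper model of f at y. *)
  have Pg := pgrad_proj y; have H := smooth_upper (y + L^-1 *: (P *m u - pgrad y)) y.
  apply: le_trans (h (y + L^-1 *: (P *m u - pgrad y))); move: H Pg.
  set fx := f (_ + _); move: (pgrad y) => g H Pg; move: H.
  have gPu : dot g (P *m u) = dot u g by rewrite -proj_dotC// Pg dotC.
  rewrite [y + _ - y]addrC addrA addNr add0r -scalemxAr mulmxBr Pg mulmxA (proj2 hP).
  rewrite !dotL (proj_dot _ _ hP) (proj_dotC _ g hP) Pg gPu (dotC y u) (dotC g u).
  set a := dot u y; set b := dot u g; set q := dot u (P *m u).
  set gg := dot g g => H.
  have Li : L / 2 * (L^-1 * (L^-1 * (q - b - (b - gg)))) = (2 * L)^-1 * (q - b - (b - gg)).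
    by field; rewrite gt_eqF.
  move: H Li; have -> : L^-1 = 2 * (2 * L)^-1 by field; rewrite gt_eqF.
  set k := (2 * L)^-1 => H Li; lra.
apply: le_trans (h y); rewrite !dotL (dotC y u).
(* Conversely, the two bounds differ by the completed square (2L)^-1 |P u - g|^2. *)
have := dot_ge0 (P *m u - pgrad y).
rewrite !dotL proj_dot// [dot (P *m u) (pgrad y)]proj_dotC//.
rewrite -[dot (pgrad y) (P *m u)]proj_dotC// pgrad_proj (dotC u (pgrad y)).
have -> : L^-1 = 2 * (2 * L)^-1 by field; rewrite gt_eqF.
have : 0 < (2 * L)^-1 by rewrite invr_gt0 mulr_gt0.
set k := (2 * L)^-1 => k0 H.
have : 0 <= k * (dot u (P *m u) - dot (pgrad y) u - (dot (pgrad y) u - dot (pgrad y) (pgrad y))).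
  by rewrite mulr_ge0//; lra.
lra.
Qed.

(** On Ker P smoothness keeps f below f 0, so a component k of u in Ker P would make the supremum in
    the conjugate infinite. The multiple of k taken at the end overshoots r by one. *)
Lemma smooth_conj_range u r : (smooth_conj u <= r%:E)%E -> P *m u = u.
Proof.
move=> /smooth_conj_le h; apply/eqP; rewrite eq_sym -subr_eq0; apply/eqP/dot_eq0.
set k := u - P *m u.
have Pk : P *m k = 0 by rewrite /k mulmxBr mulmxA (proj2 hP) subrr.
have fk s : f (s *: k) <= f 0.
  have := smooth_upper (s *: k) 0; rewrite subr0 -scalemxAr Pk scaler0 dot0r dotZr.
  by rewrite -[pgrad 0]pgrad_proj proj_dotC// Pk dot0r; lra.
have uk : dot u k = dot k k.
  by rewrite {2}/k dotDl dotNl proj_dotC// Pk dot0r subr0.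
apply/eqP; rewrite eq_le dot_ge0 andbT leNgt; apply/negP => kk.
set M := r + f 0 + (2 * L)^-1 * dot u (P *m u).
have := h (((M + 1) / dot k k) *: k); have := fk ((M + 1) / dot k k).
rewrite dotZr uk mulfVK ?gt_eqF//; rewrite /M; lra.
Qed.

Lemma smooth_conj_pgrad y : (smooth_conj (pgrad y) <=
  (dot (pgrad y) y - f y - (2 * L)^-1 * dot (pgrad y) (pgrad y))%:E)%E.
Proof.
apply/smooth_conj_le => x; rewrite pgrad_proj.
by have := convex_lower x y; rewrite dotDr dotNr; lra.
Qed.

End SmoothConjugate.

(** * Block vectors *)

Section Blocks.
Context {R : realType} {T : finType} {d : nat}.
Implicit Types (x y : 'cV[R]_(#|T| * d)) (z : 'cV[R]_d).

Lemma blkD x y k : blk (x + y) k = blk x k + blk y k.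
Proof. by apply/colP => a; rewrite !mxE. Qed.

Lemma blkN x k : blk (- x) k = - blk x k.
Proof. by apply/colP => a; rewrite !mxE. Qed.

Lemma blkZ c x k : blk (c *: x) k = c *: blk x k.
Proof. by apply/colP => a; rewrite !mxE. Qed.

Lemma blk0 k : blk (0 : 'cV[R]_(#|T| * d)) k = 0.
Proof. by apply/colP => a; rewrite !mxE. Qed.

Lemma blk_sum (I : Type) (r : seq I) (Q : pred I) (F : I -> 'cV[R]_(#|T| * d)) k :
  blk (\sum_(i <- r | Q i) F i) k = \sum_(i <- r | Q i) blk (F i) k.
Proof.
exact: (big_morph (fun x => blk x k) (fun x y => blkD x y k) (blk0 k)).
Qed.

Definition blkL := (@blkD, @blkN, @blkZ).

Lemma blk_inj x y : (forall k, blk x k = blk y k) -> x = y.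
Proof.
move=> h; apply/colP => i; case: (mxtens_indexP i) => j a.
by have /colP/(_ a) := h (enum_val j); rewrite !mxE enum_valK.
Qed.

Lemma blk_unit_vec (l k : T) (z : 'cV[R]_d) :
  blk (unit_vec l *t z) k = if k == l then z else 0.
Proof.
apply/colP => a; rewrite !mxE mxtens_indexK /= !ord1 eqxx andbT.
rewrite (inj_eq enum_rank_inj); case: (k == l); rewrite ?mul1r ?mul0r ?mxE//.
Qed.

Lemma of_blk_blk x : of_blk (blk x) = x.
Proof. by apply: blk_inj => k; rewrite of_blkK. Qed.

Lemma dot_blk x y : dot x y = \sum_k dot (blk x k) (blk y k).
Proof.
rewrite dotE (reindex (@mxtens_index #|T| d)) /=; last first.
  exists (@mxtens_unindex #|T| d) => i _; [exact: mxtens_indexK|exact: mxtens_unindexK].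
rewrite (reindex (fun p : T * 'I_d => (enum_rank p.1, p.2))) /=; last first.
  by exists (fun p => (enum_val p.1, p.2)) => -[i a] _ /=; rewrite ?enum_rankK ?enum_valK.
rewrite -(pair_big xpredT xpredT (fun k a => x (mxtens_index (enum_rank k, a)) 0 *
  y (mxtens_index (enum_rank k, a)) 0))/=.
by apply: eq_bigr => k _; rewrite dotE; apply: eq_bigr => a _; rewrite !mxE.
Qed.

Lemma dot_unit_vec x l z : dot x (unit_vec l *t z) = dot (blk x l) z.
Proof.
rewrite dot_blk (bigD1 l)//= blk_unit_vec eqxx big1 ?addr0// => k kl.
by rewrite blk_unit_vec (negbTE kl) dot0r.
Qed.

Definition bdiag (N : T -> 'M[R]_d) : 'M[R]_(#|T| * d) :=
  \sum_k (unit_vec k *m (unit_vec k)^T) *t N k.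

Lemma blk_bdiag N x k : blk (bdiag N *m x) k = N k *m blk x k.
Proof.
rewrite -[in LHS](of_blk_blk x) /of_blk mulmx_sumr blk_sum.
have unit_dot e e' : (unit_vec e')^T *m unit_vec e = (e' == e)%:R%:M :> 'M[R]_1.
  apply/matrixP => i j; rewrite !ord1 !mxE eqxx.
  rewrite (bigD1 (enum_rank e)) //= big1 => [|l /negbTE le]; last first.
    by rewrite !mxE le mulr0.
  by rewrite !mxE !eqxx addr0 mulr1 andbT (inj_eq enum_rank_inj) eq_sym.
have act l z : bdiag N *m (unit_vec l *t z) = unit_vec l *t (N l *m z).
  rewrite /bdiag mulmx_suml (bigD1 l)//= big1 ?addr0 => [|j /negbTE jl].
    by rewrite tensmx_mul -mulmxA unit_dot eqxx mulmx1.
  rewrite tensmx_mul -mulmxA unit_dot jl raddf0 mulmx0.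
  by apply/matrixP => a b; rewrite !mxE mul0r.
under eq_bigr do rewrite act blk_unit_vec.
by rewrite -big_mkcond /= (big_pred1 k) // => i; rewrite eq_sym.
Qed.

Lemma mulmx_ext k l (M N : 'M[R]_(k, l)) :
  (forall x : 'cV[R]_l, M *m x = N *m x) -> M = N.
Proof.
move=> h; apply/matrixP => i j.
by have /colP/(_ i) := h (delta_mx j 0); rewrite -!colE !mxE.
Qed.

Lemma bdiag_mul N N' : bdiag N *m bdiag N' = bdiag (fun k => N k *m N' k).
Proof.
apply: mulmx_ext => x; apply: blk_inj => k.
by rewrite -mulmxA !blk_bdiag mulmxA.
Qed.

Lemma bdiag_tr N : (bdiag N)^T = bdiag (fun k => (N k)^T).
Proof.
apply: mulmx_ext => x; apply: dot_inj => y; rewrite -dot_mulr !dot_blk.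
by apply: eq_bigr => k _; rewrite !blk_bdiag dot_mulr.
Qed.

Lemma pinv_uniq k l (M : 'M[R]_(k, l)) N : penrose M N -> pinv M = N.
Proof. exact: penrose_uniq (pinvP M). Qed.

Lemma pinv_bdiag N N' : (forall k, penrose (N k) (N' k)) ->
  pinv (bdiag N) = bdiag N'.
Proof.
move=> h; apply: pinv_uniq; split; rewrite ?bdiag_mul ?bdiag_tr; congr bdiag;
  by apply/funext => k; have [h1 h2 h3 h4] := h k.
Qed.

(** The case c = 0 rests on the convention 0^-1 = 0; it serves the edges outside a block in [Pb]. *)
Lemma penrose_scalar k (c : R) : penrose (c%:M : 'M[R]_k) (c^-1%:M).
Proof.
have [->|c0] := eqVneq c 0.
  by rewrite invr0 raddf0; split; rewrite ?mulmx0 ?mul0mx ?trmx0.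
split; rewrite -!scalar_mxM ?tr_scalar_mx//.
  by rewrite mulfV// mul1r.
by rewrite mulVf// mul1r.
Qed.

Lemma penrose_proj k (c : R) (P : 'M[R]_k) : c != 0 -> orthogonal_projector P ->
  penrose (c *: P) (c^-1 *: P).
Proof.
move=> c0 [Pt PP].
have mulZ a b : (a *: P) *m (b *: P) = (a * b) *: P.
  by rewrite -scalemxAl -scalemxAr scalerA PP.
by split; rewrite !mulZ ?mulfV ?mulVf ?mul1r ?scale1r ?Pt.
Qed.

End Blocks.

(** * The augmented graph *)

Section AugmentedGraph.
Context {R : realType} {n m d E : nat} (D : adfs_data R n m d E).
Hypothesis HD : adfs_assumptions D.

Local Notation nodevec := (nodevec R n m d).
Local Notation edgevec := (edgevec R n m d E).
Local Notation A := (Amx D).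
Local Notation Sp := (pinv (Sigma D)).
Local Notation M := (GA D).

Definition rowproj := pinv A *m A.

Local Notation Pi := rowproj.

Lemma eproj_proj e : orthogonal_projector (eproj D e).
Proof. by case: e => [c|[i j]]; [exact: projector1|exact: (Pij_proj HD)]. Qed.

Lemma blk_AmxT (g : nodevec) e : blk (A^T *m g) e =
  weight D e *: (eproj D e *m (blk g (edge_src D e) - blk g (edge_tgt D e))).
Proof.
apply: dot_inj => z; rewrite -dot_unit_vec -dot_mulr AmxE dotZr dotZl.
have -> : (unit_vec (edge_src D e) - unit_vec (edge_tgt D e)) *t (eproj D e *m z) =
   unit_vec (edge_src D e) *t (eproj D e *m z) - unit_vec (edge_tgt D e) *t (eproj D e *m z)
   :> nodevec.
  by apply/matrixP => a b; rewrite !mxE mulrBl.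
rewrite dotDr dotNr !dot_unit_vec proj_dotC; last exact: eproj_proj.
by rewrite dotDl dotNl.
Qed.

Lemma blk_Amx (lam : edgevec) k : blk (A *m lam) k =
  \sum_e (weight D e * ((k == edge_src D e)%:R - (k == edge_tgt D e)%:R)) *:
    (eproj D e *m blk lam e).
Proof.
apply: dot_inj => z; rewrite -dot_unit_vec dot_mul dot_blk dot_suml.
apply: eq_bigr => e _; rewrite blk_AmxT !blk_unit_vec !dotZr dotZl -mulrA.
congr (_ * _); rewrite -proj_dotC; last exact: eproj_proj.
rewrite dotDr dotNr ![_ == k]eq_sym mulrBl.
by do 2 case: eqP => _; rewrite ?dot0r ?mul1r ?mul0r.
Qed.

Lemma blk_Amx_virt (lam : edgevec) i j : blk (A *m lam) (inr (i, j)) =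
  - (weight D (inr (i, j)) *: (Pij D i j *m blk lam (inr (i, j)))).
Proof.
rewrite blk_Amx (bigD1 (inr (i, j)))//= big1 ?addr0 => [|[c|ij] neq].
- by rewrite eqxx sub0r mulrN1 scaleNr.
- by rewrite /= subr0 mulr0 scale0r.
- rewrite /= sub0r (_ : _ == _ = false) ?oppr0 ?mulr0 ?scale0r//.
  by apply/negbTE; rewrite eq_sym.
Qed.

(** Each column of an incidence matrix sums to zero; [primal_dual_optimality] turns this into
    stationarity of the primal objective. *)
Lemma sum_blk_Amx (lam : edgevec) : \sum_k blk (A *m lam) k = 0.
Proof.
under eq_bigr do rewrite blk_Amx.
rewrite exchange_big big1//= => e _; rewrite -scaler_suml -mulr_sumr.
rewrite sumrB (bigD1 (edge_src D e))//= [X in _ - X](bigD1 (edge_tgt D e))//= !eqxx.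
rewrite !big1 ?addr0 ?subrr ?mulr0 ?scale0r// => k /negbTE-> //.
Qed.

Definition Sigma_inv := bdiag (fun k : node n m =>
  match k with
  | inl i => (sigmai D i)^-1%:M
  | inr ij => (Lij D ij.1 ij.2)^-1 *: Pij D ij.1 ij.2
  end).

Lemma pinv_Sigma : Sp = Sigma_inv.
Proof.
apply: pinv_bdiag => -[i|[i j]]; first exact: penrose_scalar.
by apply: penrose_proj; [rewrite gt_eqF// (Lij_gt0 HD)|exact: (Pij_proj HD)].
Qed.

Lemma blk_pinv_Sigma_inl (x : nodevec) i :
  blk (Sp *m x) (inl i) = (sigmai D i)^-1 *: blk x (inl i).
Proof. by rewrite pinv_Sigma blk_bdiag mul_scalar_mx. Qed.

Lemma blk_pinv_Sigma_inr (x : nodevec) i j :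
  blk (Sp *m x) (inr (i, j)) = (Lij D i j)^-1 *: (Pij D i j *m blk x (inr (i, j))).
Proof. by rewrite pinv_Sigma blk_bdiag /= -scalemxAl. Qed.

Lemma pinv_Sigma_sym : Sp^T = Sp.
Proof.
rewrite pinv_Sigma bdiag_tr; congr bdiag; apply/funext => -[i|[i j]] /=.
  by rewrite tr_scalar_mx.
by rewrite linearZ/= (proj1 (Pij_proj HD i j)).
Qed.

Lemma pinv_Sigma_ge0 (x : nodevec) : 0 <= dot x (Sp *m x).
Proof.
rewrite dot_blk sumr_ge0// => -[i|[i j]] _.
  by rewrite blk_pinv_Sigma_inl dotZr mulr_ge0 ?dot_ge0// invr_ge0 ltW// (sigmai_gt0 HD).
rewrite blk_pinv_Sigma_inr dotZr mulr_ge0//; first by rewrite invr_ge0 ltW// (Lij_gt0 HD).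
by rewrite -proj_dot ?dot_ge0//; exact: (Pij_proj HD).
Qed.

(** At a virtual node the kernel of [Sp] is that of Pij, whereas A only produces blocks in the range
    of Pij. *)
Lemma pinv_Sigma_Amx_eq0 (lam : edgevec) : Sp *m (A *m lam) = 0 -> A *m lam = 0.
Proof.
move=> h; apply: blk_inj => -[i|[i j]]; rewrite blk0.
  have := congr1 (fun x => blk x (inl i)) h; rewrite blk_pinv_Sigma_inl blk0 => /eqP.
  by rewrite scaler_eq0 invr_eq0 gt_eqF ?(sigmai_gt0 HD)//= => /eqP.
have := congr1 (fun x => blk x (inr (i, j))) h; rewrite blk_pinv_Sigma_inr blk0 => /eqP.
rewrite scaler_eq0 invr_eq0 gt_eqF ?(Lij_gt0 HD)//= => /eqP.
by rewrite blk_Amx_virt mulmxN -scalemxAr mulmxA (proj2 (Pij_proj HD i j)).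
Qed.

Lemma Pi_proj : orthogonal_projector Pi.
Proof.
by have [h1 h2 h3 h4] := pinvP A; split=> //; rewrite /rowproj !mulmxA h2.
Qed.

Lemma Amx_Pi : A *m Pi = A.
Proof. by have [h1 _ _ _] := pinvP A; rewrite /rowproj mulmxA. Qed.

Lemma GA_sym : M^T = M.
Proof. by rewrite /GA !trmx_mul trmxK pinv_Sigma_sym mulmxA. Qed.

Lemma GA_Pi : M *m Pi = M.
Proof. by rewrite /GA -mulmxA Amx_Pi. Qed.

Lemma dot_GA (x y : edgevec) : dot x (M *m y) = dot (A *m x) (Sp *m (A *m y)).
Proof. by rewrite /GA -!mulmxA -dot_mul. Qed.

Lemma GA_ge0 (x : edgevec) : 0 <= dot x (M *m x).
Proof. by rewrite dot_GA pinv_Sigma_ge0. Qed.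

Lemma GA_ker (x : edgevec) : M *m x = 0 -> Pi *m x = 0.
Proof.
move=> Mx; rewrite /rowproj -mulmxA (_ : A *m x = 0) ?mulmx0//.
apply: pinv_Sigma_Amx_eq0; apply: psd_kernel; [exact: pinv_Sigma_sym|exact: pinv_Sigma_ge0|].
by rewrite -dot_GA Mx dot0r.
Qed.

(** The block of Pi x lies in the range of Pij, since Pi maps into the range of A^T. As the virtual
    node has a single edge, A x determines the projection by Pij of the block of x, and A Pi = A. *)
Lemma blk_Pi (x : edgevec) i j :
  blk (Pi *m x) (inr (i, j)) = Pij D i j *m blk x (inr (i, j)).
Proof.
have PiE : Pi *m x = A^T *m ((pinv A)^T *m x).
  by rewrite mulmxA -trmx_mul (proj1 Pi_proj).
have ran : Pij D i j *m blk (Pi *m x) (inr (i, j)) = blk (Pi *m x) (inr (i, j)).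
  by rewrite PiE blk_AmxT /= -scalemxAr mulmxA (proj2 (Pij_proj HD i j)).
rewrite -ran; have : blk (A *m (Pi *m x)) (inr (i, j)) = blk (A *m x) (inr (i, j)).
  by rewrite mulmxA Amx_Pi.
rewrite !blk_Amx_virt => /oppr_inj/(congr1 (fun z => (weight D (inr (i, j)))^-1 *: z)).
by rewrite !scalerA mulVf ?scale1r// gt_eqF// (weight_gt0 HD).
Qed.

Lemma blk_Pb (b : {set edge n m E}) (x : edgevec) e :
  blk (pinv (Pb D b) *m x) e = (if e \in b then (edge_prob D e)^-1 else 0) *: blk x e.
Proof.
have -> : Pb D b = bdiag (fun e => (if e \in b then edge_prob D e else 0)%:M).
  rewrite /Pb /bdiag; apply/matrixP => i j.
  case: (mxtens_indexP i) => k a; case: (mxtens_indexP j) => l c.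
  rewrite summxE; under eq_bigr do rewrite tensmxE !mxE big_ord1 !mxE eqxx !andbT.
  rewrite tensmxE (bigD1 (enum_val k))//= big1 => [|e' e'k].
    rewrite addr0 !mxE !enum_valK eqxx mul1r eq_sym.
    by case: eqP => _; rewrite ?mul0r ?mulr0n ?mul0r// !mul1r mulr1n mulr_natr.
  have -> : k == enum_rank e' = false.
    by apply/negbTE; apply: contra_neq e'k => ->; rewrite enum_rankK.
  by rewrite !mul0r.
rewrite (pinv_bdiag (N' := fun e => (if e \in b then edge_prob D e else 0)^-1%:M)).
  by rewrite blk_bdiag mul_scalar_mx; case: ifP; rewrite // invr0.
by move=> k; exact: penrose_scalar.
Qed.

End AugmentedGraph.

(** * Step bounds *)

Section StepBound.
Context {R : realType} {n m d E : nat} (D : adfs_data R n m d E).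
Hypothesis HD : adfs_assumptions D.
Variables (rho : R) (rho_gt0 : 0 < rho).
Hypothesis Hrho : ((rho ^+ 2)%:E <=
  \big[Order.min/+oo]_(b : {set edge n m E} | (0 < block_prob D b)%R) step_bound D b)%E.

Local Notation edgevec := (edgevec R n m d E).
Local Notation A := (Amx D).
Local Notation Sp := (pinv (Sigma D)).
Local Notation M := (GA D).
Local Notation Pi := (rowproj D).
Local Notation Q b := (pinv (Pb D b)).
Local Notation p := (edge_prob D).
Local Notation sigA := (sigmaA D).

Lemma sum_edge_prob (F : edge n m E -> R) :
  \sum_b block_prob D b * (\sum_(e in b) (p e)^-1 * F e) = \sum_e F e.
Proof.
under eq_bigr do rewrite big_distrr /= big_mkcond /=.
rewrite exchange_big /=; apply: eq_bigr => e _.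
rewrite -big_mkcond /= -big_distrl /= -/(edge_prob D e).
by rewrite mulrA mulfV ?mul1r// gt_eqF// (edge_prob_gt0 HD).
Qed.

Lemma dot_Pb b (x y : edgevec) :
  dot (Q b *m x) y = \sum_(e in b) (p e)^-1 * dot (blk x e) (blk y e).
Proof.
rewrite dot_blk [RHS]big_mkcond; apply: eq_bigr => e _; rewrite blk_Pb dotZl.
by case: ifP; rewrite // mul0r.
Qed.

Lemma sum_dot_Pb (x y : edgevec) :
  \sum_b block_prob D b * dot (Q b *m x) y = dot x y.
Proof. by under eq_bigr do rewrite dot_Pb; rewrite sum_edge_prob -dot_blk. Qed.

Lemma Pb_sym b : (Q b)^T = Q b.
Proof.
apply: mulmx_ext => x; apply: dot_inj => y; rewrite -dot_mulr dotC !dot_Pb.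
by apply: eq_bigr => e _; rewrite dotC.
Qed.

Lemma exists_block e : exists2 b, 0 < block_prob D b & e \in b.
Proof.
apply: contrapT => h; have := edge_prob_gt0 HD e; rewrite /edge_prob big1 ?ltxx// => b eb.
apply/eqP; rewrite eq_le (block_prob_ge0 HD) andbT leNgt; apply/negP => b0.
by apply: h; exists b.
Qed.

Lemma rho_le_step_bound b : 0 < block_prob D b -> ((rho ^+ 2)%:E <= step_bound D b)%E.
Proof. by move=> b0; apply: le_trans Hrho _; exact: bigmin_le_cond. Qed.

Lemma step_matrixE b : pinv A *m A *m Q b *m A^T *m Sp *m A *m Q b *m pinv A *m A =
  Pi *m Q b *m M *m Q b *m Pi.
Proof. by rewrite /rowproj /GA !mulmxA. Qed.

Lemma Pi_neq0 : Pi != 0.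
Proof.
apply/eqP => Pi0; have M0 : M = 0 by rewrite -(GA_Pi D) Pi0 mulmx0.
have [b b0] : exists b, 0 < block_prob D b.
  apply: contrapT => h; have := block_prob_sum1 HD.
  rewrite big1 => [/eqP|b _]; first by rewrite eq_sym oner_eq0.
  apply/eqP; rewrite eq_le (block_prob_ge0 HD) andbT leNgt; apply/negP => b0.
  by apply: h; exists b.
(* For A = 0 the value of [sigmaA] is 0, and 0 times anything, even +oo, is 0 in the extended reals:
   the step bound is 0 and excludes rho > 0. *)
have := rho_le_step_bound b0.
rewrite /step_bound /sigmaA M0 lambda_min_pos0 mul0e lee_fin.
by rewrite leNgt exprn_gt0.
Qed.

Lemma sigmaA_gt0 : 0 < sigA.
Proof.
exact: (lambda_min_pos_gt0_le (GA_sym HD) (GA_ge0 HD) (Pi_proj D) (GA_Pi D) (GA_ker HD) Pi_neq0).1.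
Qed.

Lemma sigmaA_le (x : edgevec) : sigA * dot x (Pi *m x) <= dot x (M *m x).
Proof.
exact: (lambda_min_pos_gt0_le (GA_sym HD) (GA_ge0 HD) (Pi_proj D) (GA_Pi D) (GA_ker HD) Pi_neq0).2.
Qed.

Lemma rho_GA_le b (x : edgevec) : 0 < block_prob D b ->
  rho ^+ 2 * dot (Q b *m (Pi *m x)) (M *m (Q b *m (Pi *m x))) <= sigA * dot x (Pi *m x).
Proof.
move=> b0; have := rho_le_step_bound b0; rewrite /step_bound step_matrixE.
set S := Pi *m _ *m _ *m _ *m _; have [Pit PiPi] := Pi_proj D.
have St : S^T = S.
  rewrite /S; move: (Pi) Pit (M) (GA_sym HD) => T Tt N Nt.
  by rewrite !trmx_mul Tt Pb_sym Nt !mulmxA.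
have dS y : dot y (S *m y) = dot (Q b *m (Pi *m y)) (M *m (Q b *m (Pi *m y))).
  have -> : S *m y = Pi *m (Q b *m (M *m (Q b *m (Pi *m y)))) by rewrite /S !mulmxA.
  by rewrite dot_mulr Pit dot_mulr Pb_sym.
have S0 y : 0 <= dot y (S *m y) by rewrite dS (GA_ge0 HD).
have := lambda_max_ub (Pi *m x) St; rewrite dS [Pi *m (Pi *m x)]mulmxA PiPi.
rewrite (proj_dot _ _ (Pi_proj D)) => h.
have Pix0 : 0 <= dot x (Pi *m x) by rewrite -proj_dot ?dot_ge0//; exact: Pi_proj.
have G0 := GA_ge0 HD (Q b *m (Pi *m x)).
set l := lambda_max S in h *.
(* Only l > 0 uses the bound on rho; in the other cases the nonnegative form of S vanishes at x. *)
have [l0|l0|l0] := ltrgt0P l.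
- rewrite inver gt_eqF// -EFinM lee_fin ler_pdivlMr// => h'.
  have := ler_wpM2l (ltW (exprn_gt0 2 rho_gt0)) h; nra.
- move=> _; have -> : dot (Q b *m (Pi *m x)) (M *m (Q b *m (Pi *m x))) = 0 by nra.
  by rewrite mulr0 mulr_ge0// ltW// sigmaA_gt0.
- rewrite l0 mul0r in h; move=> _.
  have -> : dot (Q b *m (Pi *m x)) (M *m (Q b *m (Pi *m x))) = 0 by lra.
  by rewrite mulr0 mulr_ge0// ltW// sigmaA_gt0.
Qed.

(* The block sampling is unbiased, so by Jensen's inequality some block has step
   bound at most 1. *)
Lemma rho_le1 : rho <= 1.
Proof.
have /matrix0Pn[k [l Pkl]] := Pi_neq0; have [Pit PiPi] := Pi_proj D.
pose x : edgevec := Pi *m delta_mx l 0; have Pix : Pi *m x = x by rewrite /x mulmxA PiPi.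
have x0 : 0 < dot x x.
  by apply: dot_gt0; apply/eqP => /colP/(_ k)/eqP;
    rewrite /x -colE [X in _ == X]mxE [X in X == _]mxE (negbTE Pkl).
have s0 := sigmaA_gt0; have Mx := sigmaA_le x; rewrite Pix in Mx.
have avg : rho ^+ 2 * dot x (M *m x) <= sigA * dot x x.
  rewrite -[leRHS]mul1r -(block_prob_sum1 HD) mulr_suml.
  (* Jensen by tangents: 2 <Q x, M x> - <x, M x> is at most the form of M at Q x, and its mean is
     <x, M x> because Q is unbiased. *)
  have -> : dot x (M *m x) = \sum_b block_prob D b *
      (2 * dot (Q b *m x) (M *m x) - dot x (M *m x)).
    under eq_bigr do rewrite mulrBr mulrCA.
    rewrite sumrB -mulr_sumr sum_dot_Pb -mulr_suml (block_prob_sum1 HD); ring.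
  rewrite mulr_sumr; apply: ler_sum => b _; rewrite mulrCA.
  have := block_prob_ge0 HD b; rewrite le_eqVlt => /predU1P[<-|b0]; first by rewrite !mul0r.
  rewrite ler_pM2l//; have := rho_GA_le x b0; rewrite Pix => h; apply: le_trans h.
  rewrite ler_wpM2l ?sqr_ge0//; have := GA_ge0 HD (Q b *m x - x).
  rewrite mulmxBr !dotL (_ : dot x (M *m (Q b *m x)) = dot (Q b *m x) (M *m x)); first lra.
  by rewrite dot_mulr (GA_sym HD) dotC.
have : rho ^+ 2 * (sigA * dot x x) <= 1 * (sigA * dot x x).
  by rewrite mul1r; apply: le_trans avg; rewrite ler_wpM2l// sqr_ge0.
rewrite ler_pM2r ?mulr_gt0// => h; nra.
Qed.

(** By [blk_Pi] such a y satisfies <y, Pi y> = |y|^2, and a projector keeps the length only of the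
    vectors that it fixes. *)
Lemma Pi_virtual (y : edgevec) : (forall c, blk y (inl c) = 0) ->
  (forall i j, Pij D i j *m blk y (inr (i, j)) = blk y (inr (i, j))) -> Pi *m y = y.
Proof.
move=> yc yv; apply/eqP; rewrite -subr_eq0; apply/eqP/dot_eq0.
have h : dot y (Pi *m y) = dot y y.
  rewrite !dot_blk; apply: eq_bigr => -[c|[i j]] _; first by rewrite yc !dot0l.
  by rewrite blk_Pi// yv.
rewrite !dotL proj_dot; last exact: Pi_proj.
by rewrite (dotC _ y) h; ring.
Qed.

(** For x carried by this edge alone, Pi x = x and Q x = x / p, so the step bound reads (rho / p)^2
    <x, M x> <= sigA |x|^2 <= <x, M x>. A nonzero Pij provides such an x. *)
Lemma rho_le_prob i j : Pij D i j != 0 -> rho <= p (inr (i, j)).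
Proof.
move=> /matrix0Pn[k [l Pkl]]; have hP := Pij_proj HD i j.
pose z : 'cV[R]_d := Pij D i j *m delta_mx l 0.
have Pz : Pij D i j *m z = z by rewrite /z mulmxA (proj2 hP).
pose x : edgevec := unit_vec (inr (i, j) : edge n m E) *t z.
have Pix : Pi *m x = x.
  apply: Pi_virtual => [c|i' j']; rewrite blk_unit_vec//.
  by case: eqP => [[-> ->]|_]; rewrite ?mulmx0.
have x0 : 0 < dot x x.
  rewrite dot_unit_vec blk_unit_vec eqxx; apply: dot_gt0.
  by apply/eqP => /colP/(_ k)/eqP; rewrite /z -colE [X in _ == X]mxE [X in X == _]mxE (negbTE Pkl).
have [b b0 eb] := exists_block (inr (i, j)).
have Qx : Q b *m x = (p (inr (i, j)))^-1 *: x.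
  apply: blk_inj => e; rewrite blk_Pb blkZ blk_unit_vec.
  by case: eqP => [->|_]; rewrite ?scaler0// eb.
have := rho_GA_le x b0; rewrite Pix Qx -scalemxAr dotZl dotZr.
have := sigmaA_le x; rewrite Pix; have := sigmaA_gt0.
set p0 := p _; have p00 : 0 < p0 by exact: (edge_prob_gt0 HD).
set N := dot x (M *m x) => s0 h1 h2.
have : (rho / p0) ^+ 2 * (sigA * dot x x) <= 1 * (sigA * dot x x).
  rewrite mul1r; apply: le_trans h2; rewrite expr_div_n -exprVn.
  apply: le_trans (ler_wpM2l _ h1) _; first by rewrite mulr_ge0// sqr_ge0.
  by rewrite expr2 -!mulrA.
rewrite ler_pM2r ?mulr_gt0// => h.
have : rho / p0 <= 1 by have : 0 < rho / p0 by [rewrite divr_gt0]; nra.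
by rewrite ler_pdivrMr// mul1r.
Qed.

End StepBound.

(** * The dual problem *)

Section DualProblem.
Context {R : realType} {n m d E : nat} (D : adfs_data R n m d E).
Hypothesis HD : adfs_assumptions D.

Local Notation nodevec := (nodevec R n m d).
Local Notation edgevec := (edgevec R n m d E).
Local Notation A := (Amx D).
Local Notation Sp := (pinv (Sigma D)).
Local Notation M := (GA D).
Local Notation mu i j := (weight D (inr (i, j))).
Local Notation vedge := ('I_n * 'I_m)%type.

Lemma fenchel_t_affine i j u r : (fenchel_t D i j u <= r%:E)%E <->
  forall y, dot (y - (Lij D i j)^-1 *: pgrad (fij D i j) (Pij D i j) y) u +
    ((2 * Lij D i j)^-1 * dot (pgrad (fij D i j) (Pij D i j) y)
      (pgrad (fij D i j) (Pij D i j) y) - fij D i j y) <= r.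
Proof.
exact: (smooth_conj_affine (Pij_proj HD i j) (Lij_gt0 HD i j) (fij_smooth HD i j)).
Qed.

Lemma fenchel_t_le i j u r : (fenchel_t D i j u <= r%:E)%E <->
  forall y, dot u y - fij D i j y - (2 * Lij D i j)^-1 * dot u (Pij D i j *m u) <= r.
Proof. exact: smooth_conj_le. Qed.

Lemma fenchel_t_pgrad i j y (g := pgrad (fij D i j) (Pij D i j) y) :
  (fenchel_t D i j g <= (dot g y - fij D i j y - (2 * Lij D i j)^-1 * dot g g)%:E)%E.
Proof.
exact: (smooth_conj_pgrad (Pij_proj HD i j) (Lij_gt0 HD i j) (fij_convex HD i j) (fij_smooth HD i j)).
Qed.

Lemma psi_ij_neqNy i j x : psi_ij D i j x != -oo%E.
Proof. exact: (sup_affine_neqNy 0 (fenchel_t_affine i j)). Qed.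

Lemma psi_ij_fin i j x r : (psi_ij D i j x <= r%:E)%E ->
  (fine (psi_ij D i j x))%:E = psi_ij D i j x.
Proof. exact: (sup_affine_fin 0 (fenchel_t_affine i j)). Qed.

Lemma psi_ij_convex i j x1 x2 r1 r2 c1 c2 :
  (psi_ij D i j x1 <= r1%:E)%E -> (psi_ij D i j x2 <= r2%:E)%E ->
  0 <= c1 -> 0 <= c2 -> c1 + c2 = 1 ->
  (psi_ij D i j (c1 *: x1 + c2 *: x2)%R <= (c1 * r1 + c2 * r2)%:E)%E.
Proof.
move=> h1 h2 c10 c20 c12; rewrite /psi_ij.
have -> : - (mu i j *: (c1 *: x1 + c2 *: x2)) =
    c1 *: (- (mu i j *: x1)) + c2 *: (- (mu i j *: x2)).
  by apply/colP => a; rewrite !mxE; ring.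
exact: (sup_affine_convex (fenchel_t_affine i j)).
Qed.

Lemma psi_ij_range i j x r : (psi_ij D i j x <= r%:E)%E -> Pij D i j *m x = x.
Proof.
move=> /(smooth_conj_range (Pij_proj HD i j) (fij_smooth HD i j)).
rewrite mulmxN -scalemxAr => /oppr_inj/(congr1 (fun z => (mu i j)^-1 *: z)).
by rewrite !scalerA mulVf ?scale1r// gt_eqF// (weight_gt0 HD).
Qed.

(** The edge variable that the scaling inside [psi_ij] sends to a gradient of f_ij, where the
    conjugate is finite by the Fenchel equality. *)
Definition psi_point i j y : 'cV[R]_d :=
  - ((mu i j)^-1 *: pgrad (fij D i j) (Pij D i j) y).

Lemma psi_pointK i j y : - (mu i j *: psi_point i j y) = pgrad (fij D i j) (Pij D i j) y.
Proof.
by rewrite /psi_point scalerN opprK scalerA mulfV ?scale1r// gt_eqF// (weight_gt0 HD).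
Qed.

Lemma psi_ij_point i j y : (psi_ij D i j (psi_point i j y) <=
  (dot (pgrad (fij D i j) (Pij D i j) y) y - fij D i j y -
   (2 * Lij D i j)^-1 * dot (pgrad (fij D i j) (Pij D i j) y)
                            (pgrad (fij D i j) (Pij D i j) y))%:E)%E.
Proof. by rewrite /psi_ij psi_pointK; exact: fenchel_t_pgrad. Qed.

(** The proximal map of the algorithm in edge variables: for z in the range of Pij, the block of A
    at the virtual node is -mu z. *)
Definition dual_prox rho i j z : 'cV[R]_d :=
  - ((mu i j)^-1 *: prox_edge D rho i j (- (mu i j *: z))).

Lemma prox_edgeE rho i j z :
  prox_edge D rho i j (- (mu i j *: z)) = - (mu i j *: dual_prox rho i j z).
Proof.
by rewrite /dual_prox scalerN opprK scalerA mulfV ?scale1r// gt_eqF// (weight_gt0 HD).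
Qed.

(** The substitution z -> -mu z absorbs the factor mu^2 of the proximal step eta mu^2 / p and leaves
    eta / p, the step of coordinate descent on this edge. *)
Lemma dual_prox_le rho i j z x r : 0 < stepsize D rho ->
  (psi_ij D i j x <= r%:E)%E ->
  (psi_ij D i j (dual_prox rho i j z) <=
    (r - edge_prob D (inr (i, j)) / stepsize D rho *
       dot (z - dual_prox rho i j z) (x - dual_prox rho i j z))%:E)%E.
Proof.
move=> eta0 hx; have mu0 := weight_gt0 HD (inr (i, j)).
have p0 := edge_prob_gt0 HD (inr (i, j)).
have h0 : 0 < stepsize D rho * mu i j ^+ 2 * (edge_prob D (inr (i, j)))^-1.
  by rewrite mulr_gt0 ?invr_gt0// mulr_gt0// exprn_gt0.
have := prox_le 0 (fenchel_t_affine i j) (- (mu i j *: z)) h0 hx hx.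
rewrite -/(prox_edge D rho i j _) prox_edgeE -/(psi_ij D i j _).
move: (dual_prox _ _ _ _) => v.
have dE (y : 'cV[R]_d) : - (mu i j *: y) - - (mu i j *: v) = - (mu i j *: (y - v)).
  by apply/colP => a; rewrite !mxE; ring.
rewrite !dE !(dotNl, dotNr, dotZl, dotZr) !(mulrN, opprK).
set q := dot _ _; set h := _ / _.
suff -> : h^-1 * (mu i j * (mu i j * q)) = edge_prob D (inr (i, j)) / stepsize D rho * q by [].
rewrite /h; field; by rewrite !gt_eqF.
Qed.

Definition psiv (lam : edgevec) (ij : vedge) : R :=
  fine (psi_ij D ij.1 ij.2 (blk lam (inr ij))).

Lemma dual_obj_le lam (s : vedge -> R) :
  (forall ij, psi_ij D ij.1 ij.2 (blk lam (inr ij)) <= (s ij)%:E)%E ->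
  (dual_obj D lam <= (qA D lam + \sum_ij s ij)%:E)%E.
Proof.
move=> h; rewrite /dual_obj /psi EFinD leeD2l// pair_bigA/= -sumEFin.
by apply: lee_sum => -[i j] _; exact: h.
Qed.

Lemma dual_obj_fin lam r : (dual_obj D lam <= r%:E)%E ->
  (forall ij, psi_ij D ij.1 ij.2 (blk lam (inr ij)) = (psiv lam ij)%:E) /\
  dual_obj D lam = (qA D lam + \sum_ij psiv lam ij)%:E.
Proof.
move=> h.
have fin ij : psi_ij D ij.1 ij.2 (blk lam (inr ij)) = (psiv lam ij)%:E.
  case: ij => i j /=.
  rewrite /psiv fineK// fin_numE psi_ij_neqNy/=; apply/eqP => e.
  move: h; rewrite /dual_obj /psi pair_bigA/= (bigD1 (i, j))//= e addye.
    by rewrite addey// leye_eq.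
  rewrite esum_eqNy; apply/existsP => -[kl /andP[_ /eqP]].
  by apply/eqP/psi_ij_neqNy.
split=> //; rewrite /dual_obj /psi pair_bigA/= EFinD -sumEFin; congr (_ + _)%E.
by apply: eq_bigr => -[i j] _; rewrite -fin.
Qed.

Definition feasible_point : edgevec :=
  of_blk (fun e : edge n m E => if e is inr ij then psi_point ij.1 ij.2 0 else 0).

Section Minimizer.
Variable lamS : edgevec.
Hypothesis Hmin : forall lam, (dual_obj D lamS <= dual_obj D lam)%E.

(** Were the dual infinite everywhere, every point would minimise it; [feasible_point] excludes
    this. *)
Lemma minimizer_fin :
  (forall ij, psi_ij D ij.1 ij.2 (blk lamS (inr ij)) = (psiv lamS ij)%:E) /\
  dual_obj D lamS = (qA D lamS + \sum_ij psiv lamS ij)%:E.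
Proof.
apply: dual_obj_fin; apply: le_trans (Hmin feasible_point) (dual_obj_le _) => ij.
rewrite of_blkK; exact: psi_ij_point.
Qed.

Lemma minimizer_psi i j : psi_ij D i j (blk lamS (inr (i, j))) = (psiv lamS (i, j))%:E.
Proof. exact: (minimizer_fin.1 (i, j)). Qed.

Lemma minimizer_le lam (s : vedge -> R) :
  (forall ij, psi_ij D ij.1 ij.2 (blk lam (inr ij)) <= (s ij)%:E)%E ->
  qA D lamS + \sum_ij psiv lamS ij <= qA D lam + \sum_ij s ij.
Proof.
move=> h; rewrite -lee_fin -minimizer_fin.2.
exact: le_trans (Hmin lam) (dual_obj_le h).
Qed.

Lemma qAE (lam : edgevec) : qA D lam = 2^-1 * dot lam (M *m lam).
Proof. by rewrite /qA qformE. Qed.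

(** Minus the gradient of q_A at l is a subgradient of psi there: compare l with l + t (lam - l),
    where the quadratic remainder is of order t^2. *)
Lemma minimizer_first_order lam (s : vedge -> R) :
  (forall ij, psi_ij D ij.1 ij.2 (blk lam (inr ij)) <= (s ij)%:E)%E ->
  \sum_ij psiv lamS ij <= \sum_ij s ij + dot (M *m lamS) (lam - lamS).
Proof.
move=> h; set S0 := \sum_ij psiv _ _; set S1 := \sum_ij s ij.
set g := dot _ _; set c := 2^-1 * dot (lam - lamS) (M *m (lam - lamS)).
have c0 : 0 <= c by rewrite mulr_ge0 ?(GA_ge0 HD)// invr_ge0.
have key t : 0 < t -> t <= 1 -> S0 <= S1 + g + t * c.
  move=> t0 t1.
  have := @minimizer_le (t *: lam + (1 - t) *: lamS)
    (fun ij => t * s ij + (1 - t) * psiv lamS ij) _.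
  have conv ij : (psi_ij D ij.1 ij.2 (blk (t *: lam + (1 - t) *: lamS)%R (inr ij)) <=
      (t * s ij + (1 - t) * psiv lamS ij)%:E)%E.
    have hS : (psi_ij D ij.1 ij.2 (blk lamS (inr ij)) <= (psiv lamS ij)%:E)%E.
      by case: ij => i j; rewrite minimizer_psi.
    rewrite !blkL; have := h ij; case: ij hS => i j hS hl.
    by apply: (psi_ij_convex hl hS); lra.
  move=> /(_ conv).
  rewrite big_split/= -!mulr_sumr -/S0 -/S1.
  have -> : t *: lam + (1 - t) *: lamS = lamS + t *: (lam - lamS).
    by apply/colP => a; rewrite !mxE; ring.
  rewrite !qAE mulmxDr -scalemxAr !(dotDl lamS) !(dotDr lamS) !(dotDr (t *: _)) !dotZl !dotZr.
  have -> : dot lamS (M *m (lam - lamS)) = g by rewrite dot_mulr (GA_sym HD).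
  rewrite (dotC (lam - lamS) (M *m lamS)) -/g.
  move: c0; rewrite /c; set q := dot (lam - lamS) _; set q0 := dot lamS _ => c0 H.
  rewrite -(ler_pM2l t0); nra.
apply/ler_addgt0Pr => e e0.
have sp : 0 < Num.min 1 (e / (c + 1)) by rewrite lt_min ltr01 divr_gt0//; lra.
apply: le_trans (key _ sp _) _; first by rewrite ge_min lexx.
rewrite lerD2l; apply: le_trans (_ : e / (c + 1) * c <= _).
  by rewrite ler_wpM2r// ge_min lexx orbT.
by rewrite mulrAC ler_pdivrMr; nra.
Qed.

Let theta : nodevec := Sp *m (A *m lamS).

Lemma blk_grad e : blk (M *m lamS) e =
  weight D e *: (eproj D e *m (blk theta (edge_src D e) - blk theta (edge_tgt D e))).
Proof. by rewrite /GA -!mulmxA blk_AmxT. Qed.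

Lemma minimizer_first_order_at (e : edge n m E) z (s : vedge -> R) :
  (forall ij, inr ij != e -> s ij = psiv lamS ij) ->
  (forall ij, inr ij = e -> psi_ij D ij.1 ij.2 z <= (s ij)%:E)%E ->
  \sum_ij psiv lamS ij <= \sum_ij s ij + dot (blk (M *m lamS) e) (z - blk lamS e).
Proof.
move=> s1 s2.
have := @minimizer_first_order (lamS + unit_vec e *t (z - blk lamS e)) s _.
rewrite [lamS + _ - lamS]addrC addKr dot_unit_vec; apply => ij.
rewrite blkD blk_unit_vec; case: eqP => [e'|/eqP e'].
  by rewrite e' addrC subrK; apply: s2.
by rewrite addr0 minimizer_fin.1 s1.
Qed.

(** psi ignores communication edges, so the gradient of q_A vanishes on them; its block is the
    weighted difference of theta at the two ends. *)
Lemma consensus_edge c : blk theta (inl (comm_src D c)) = blk theta (inl (comm_tgt D c)).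
Proof.
set g := blk (M *m lamS) (inl c).
have g0 : g = 0.
  apply: dot_eq0; apply/eqP; rewrite eq_le dot_ge0 andbT.
  have := @minimizer_first_order_at (inl c) (blk lamS (inl c) - g) (psiv lamS).
  by rewrite [_ - g - _]addrC addKr -/g dotNr => /(_ (fun _ _ => erefl) ltac:(by [])); lra.
move: g0; rewrite /g blk_grad mul1mx => /eqP; rewrite scaler_eq0 gt_eqF ?(weight_gt0 HD)//=.
by rewrite subr_eq0 => /eqP.
Qed.

Lemma consensus i k : blk theta (inl i) = blk theta (inl k).
Proof.
have /connectP[q] := comm_connected HD i k.
elim: q i => [|l q IH] i /=; first by move=> _ ->.
move=> /andP[/existsP[c il] ql] kE; rewrite -(IH l)//.
by case/orP: il => /andP[/eqP <- /eqP <-]; rewrite consensus_edge.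
Qed.

(** Move l on the edge (i, j) only, to [psi_point] at the common value th. With g the projected
    gradient at th and u the block of A l, the first-order condition and Fenchel's inequality give
    the claim with the surplus (2L)^-1 |u - g|^2. At the virtual node theta is u / L, which restores
    the quadratic removed from the conjugate. *)
Lemma dual_subgradient i j k x :
  fij D i j (blk theta (inl k)) +
    dot (blk (A *m lamS) (inr (i, j))) (x - blk theta (inl k)) <= fij D i j x.
Proof.
set u := blk _ (inr (i, j)); set th := blk theta (inl k).
have hP := Pij_proj HD i j; have mu0 := weight_gt0 HD (inr (i, j)); have L0 := Lij_gt0 HD i j.
set g := pgrad (fij D i j) (Pij D i j) th.
have Pg : Pij D i j *m g = g by exact: pgrad_proj.
have Plam : Pij D i j *m blk lamS (inr (i, j)) = blk lamS (inr (i, j)).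
  by apply: (@psi_ij_range i j _ (psiv lamS (i, j))); rewrite minimizer_psi.
have uE : u = - (mu i j *: blk lamS (inr (i, j))) by rewrite /u blk_Amx_virt// Plam.
have Pu : Pij D i j *m u = u by rewrite uE mulmxN -scalemxAr Plam.
have thv : blk theta (inr (i, j)) = (Lij D i j)^-1 *: u by rewrite blk_pinv_Sigma_inr// Pu.
pose sg := dot g th - fij D i j th - (2 * Lij D i j)^-1 * dot g g.
pose s ij := if ij == (i, j) then sg else psiv lamS ij.
have := @minimizer_first_order_at (inr (i, j)) (psi_point i j th) s _ _.
have s1 ij : inr ij != inr (i, j) :> edge n m E -> s ij = psiv lamS ij.
  by rewrite /s (inj_eq inr_inj) => /negbTE ->.
have s2 ij : inr ij = inr (i, j) :> edge n m E ->
    (psi_ij D ij.1 ij.2 (psi_point i j th) <= (s ij)%:E)%E.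
  by case=> ->; rewrite /s eqxx; exact: psi_ij_point.
move=> /(_ s1 s2); rewrite (bigD1 (i, j))//= [X in _ <= X + _](bigD1 (i, j))//= {1}/s eqxx.
rewrite [X in _ <= _ + X + _](eq_bigr (psiv lamS)); last by move=> ij /negbTE; rewrite /s => ->.
have : (fenchel_t D i j u <= (psiv lamS (i, j))%:E)%E.
  by rewrite uE -/(psi_ij D i j _) minimizer_psi.
move=> /fenchel_t_le/(_ x); rewrite Pu.
rewrite blk_grad /= (consensus i k) -/th thv.
have -> : psi_point i j th - blk lamS (inr (i, j)) = (mu i j)^-1 *: (u - g).
  by rewrite uE /psi_point -/g; apply/colP => a; rewrite !mxE; field; rewrite gt_eqF.
rewrite dotZl dotZr mulrA mulfV ?gt_eqF// mul1r proj_dotC// mulmxBr Pu Pg.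
rewrite /sg !dotL (dotC g th) (dotC u th).
have := dot_ge0 (u - g); rewrite !dotL (dotC g u).
set X := \sum_(_ | _) _.
have -> : (Lij D i j)^-1 = 2 * (2 * Lij D i j)^-1 by field; rewrite gt_eqF.
have : 0 < (2 * Lij D i j)^-1 by rewrite invr_gt0 mulr_gt0.
set c := (2 * _)^-1; move: (dot u u) (dot g g) (dot u g) (dot u x) => uu gg ug ux.
move: (dot th u) (dot th g) (fij D i j x) (fij D i j th) (psiv _ _) => tu tg fx ft ps.
move=> c0 sq h1 h2.
have : 0 <= c * (uu - ug - (ug - gg)) by apply: mulr_ge0; [exact: ltW|lra].
lra.
Qed.

(** At node k the block of A l is sigma_k th, so the blocks of A l summing to zero says that minus
    the gradient of the total quadratic term at th is a sum of subgradients of the f_ij. Strong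
    convexity then leaves only one minimizer. *)
Lemma primal_dual_optimality theta_star i :
  (forall x, primal_obj D theta_star <= primal_obj D x) ->
  blk theta (inl i) = theta_star.
Proof.
move=> Hstar; set th := blk theta (inl i).
have sig k : sigmai D k *: th = blk (A *m lamS) (inl k).
  rewrite /th (consensus i k) blk_pinv_Sigma_inl// scalerA mulfV ?scale1r//.
  by rewrite gt_eqF// (sigmai_gt0 HD).
pose U := \sum_(k < n) \sum_(j < m) blk (A *m lamS) (inr (k, j)).
have sum0 : (\sum_k sigmai D k) *: th + U = 0.
  rewrite scaler_suml (eq_bigr _ (fun k _ => sig k)) /U pair_bigA/=.
  apply: etrans (sum_blk_Amx HD lamS).
  by rewrite [RHS]big_sumType/=; congr (_ + _); apply: eq_bigr => -[].
pose S := \sum_k sigmai D k.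
have S0 : 0 < S.
  rewrite /S (bigD1 i)//= ltr_pwDl ?(sigmai_gt0 HD)// sumr_ge0// => k _.
  by rewrite ltW// (sigmai_gt0 HD).
have primalE x : primal_obj D x =
    \sum_(k < n) \sum_(j < m) fij D k j x + S / 2 * dot x x.
  rewrite /primal_obj /fi big_split/= /S !mulr_suml.
  by congr (_ + _); apply: eq_bigr => k _; rewrite sqnormE.
have := Hstar th; rewrite !primalE.
have : \sum_(k < n) \sum_(j < m) fij D k j th + dot U (theta_star - th) <=
    \sum_(k < n) \sum_(j < m) fij D k j theta_star.
  rewrite /U dot_suml -big_split/=; apply: ler_sum => k _.
  rewrite dot_suml -big_split/=; apply: ler_sum => j _; exact: dual_subgradient.
have -> : U = - (S *: th) by apply/eqP; rewrite -addr_eq0 addrC sum0.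
have -> : theta_star = th + (theta_star - th) by rewrite addrC subrK.
move: (theta_star - th) => z; rewrite [th + z - th]addrC addKr.
rewrite !dotL (dotC z th) => h1 h2.
have zz : S / 2 * dot z z <= 0 by lra.
suff -> : z = 0 by rewrite addr0.
apply: dot_eq0; apply/eqP; rewrite eq_le dot_ge0 andbT.
by rewrite pmulr_rle0// divr_gt0 in zz.
Qed.

End Minimizer.
End DualProblem.

(** * Accelerated descent on the dual *)

Section DualIterates.
Context {R : realType} {n m d E : nat} (D : adfs_data R n m d E).
Hypothesis HD : adfs_assumptions D.
Variables (rho : R) (rho_gt0 : 0 < rho).
Hypothesis Hrho : ((rho ^+ 2)%:E <=
  \big[Order.min/+oo]_(b : {set edge n m E} | (0 < block_prob D b)%R) step_bound D b)%E.

Local Notation edgevec := (edgevec R n m d E).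
Local Notation edge := (edge n m E).
Local Notation block := {set edge}.
Local Notation A := (Amx D).
Local Notation M := (GA D).
Local Notation Pi := (rowproj D).
Local Notation Q b := (pinv (Pb D b)).
Local Notation p := (edge_prob D).
Local Notation sigA := (sigmaA D).
Local Notation eta := (stepsize D rho).
Local Notation mu i j := (weight D (inr (i, j))).
Local Notation vedge := ('I_n * 'I_m)%type.

(* [ds] and [dphi] are bounds for psi at [dx] and [dv]. *)
Record dual_state := DualState {
  dx : edgevec;
  dv : edgevec;
  ds : vedge -> R;
  dphi : vedge -> R }.

Definition psi_fin (ij : vedge) z : R := fine (psi_ij D ij.1 ij.2 z).

Section Step.
Variables (b : block) (st : dual_state).

Definition dy : edgevec := (1 + rho)^-1 *: (dx st + rho *: dv st).
Definition dw : edgevec := (1 - rho) *: dv st + rho *: dy.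
Definition dsy ij : R := (1 + rho)^-1 * (ds st ij + rho * dphi st ij).
Definition dsw ij : R := (1 - rho) * dphi st ij + rho * dsy ij.
Definition dgrad : edgevec := M *m dy.
Definition dprox (ij : vedge) : 'cV[R]_d :=
  dual_prox D rho ij.1 ij.2
    (blk dw (inr ij) - (eta / p (inr ij)) *: blk dgrad (inr ij)).

Definition dv_next : edgevec :=
  if b \subset virtual_edges then
    of_blk (fun e : edge => match e with
      | inl c => blk dw (inl c)
      | inr ij => if inr ij \in b then dprox ij else blk dw (inr ij)
      end)
  else dw - eta *: (Q b *m dgrad).

(** The first field mirrors the node update because [A *m Q b *m Pi] equals [Wtb D b *m A]. On a
    drawn edge [ds] moves as x does, by rho / p times the change from w to the new v. *)
Definition dual_step := DualState
  (dy + rho *: (Q b *m (Pi *m (dv_next - dw))))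
  dv_next
  (fun ij => dsy ij +
     if inr ij \in b then rho / p (inr ij) * (psi_fin ij (dprox ij) - dsw ij) else 0)
  (fun ij => if inr ij \in b then psi_fin ij (dprox ij) else dsw ij).

End Step.

Lemma dv_step b st : dv (dual_step b st) = dv_next b st.
Proof. by []. Qed.

Lemma ds_step b st ij : ds (dual_step b st) ij = dsy st ij +
  if inr ij \in b then rho / p (inr ij) * (psi_fin ij (dprox st ij) - dsw st ij) else 0.
Proof. by []. Qed.

Lemma dphi_step b st ij : dphi (dual_step b st) ij =
  if inr ij \in b then psi_fin ij (dprox st ij) else dsw st ij.
Proof. by []. Qed.

(** On such states the factor Pij, by which Pi acts on virtual edges, disappears from the
    recursions. *)
Definition ranged st := forall i j,
  Pij D i j *m blk (dx st) (inr (i, j)) = blk (dx st) (inr (i, j)) /\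
  Pij D i j *m blk (dv st) (inr (i, j)) = blk (dv st) (inr (i, j)).

Lemma stepsize_gt0 : 0 < eta.
Proof. by rewrite divr_gt0// (sigmaA_gt0 HD rho_gt0 Hrho). Qed.

Lemma sigma_stepsize : sigA * eta = rho.
Proof. by rewrite /stepsize mulrC mulfVK// gt_eqF// (sigmaA_gt0 HD rho_gt0 Hrho). Qed.

Lemma psi_dprox st ij : psi_ij D ij.1 ij.2 (dprox st ij) = (psi_fin ij (dprox st ij))%:E.
Proof.
apply/esym.
exact: (psi_ij_fin HD (dual_prox_le HD _ stepsize_gt0 (psi_ij_point HD ij.1 ij.2 0))).
Qed.

Lemma dprox_range st i j : Pij D i j *m dprox st (i, j) = dprox st (i, j).
Proof.
apply: (psi_ij_range HD (r := psi_fin (i, j) (dprox st (i, j)))).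
by rewrite (psi_dprox st (i, j)).
Qed.

Lemma dy_range st i j : ranged st -> Pij D i j *m blk (dy st) (inr (i, j)) = blk (dy st) (inr (i, j)).
Proof. by move=> /(_ i j)[hx hv]; rewrite /dy !blkL -scalemxAr mulmxDr -scalemxAr hx hv. Qed.

Lemma dw_range st i j : ranged st -> Pij D i j *m blk (dw st) (inr (i, j)) = blk (dw st) (inr (i, j)).
Proof.
move=> rst; have [hx hv] := rst i j.
by rewrite /dw blkD (blkZ (1 - rho)) (blkZ rho) mulmxDr -!scalemxAr hv dy_range.
Qed.

Lemma GA_range (y : edgevec) i j : Pij D i j *m blk (M *m y) (inr (i, j)) = blk (M *m y) (inr (i, j)).
Proof.
rewrite /GA -!mulmxA (blk_AmxT HD) /= -scalemxAr.
by rewrite [Pij D i j *m (Pij D i j *m _)]mulmxA (proj2 (Pij_proj HD i j)).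
Qed.

Lemma blk_dv_next b st (i : 'I_n) (j : 'I_m) : (0 < block_prob D b) ->
  blk (dv_next b st) (inr (i, j)) =
  if inr (i, j) \in b then dprox st (i, j) else blk (dw st) (inr (i, j)).
Proof.
move=> b0; rewrite /dv_next; case: ifP => bv; first by rewrite of_blkK.
have /orP[bc|] := block_prob_pure HD b0; last by rewrite bv.
have nb : (inr (i, j) \in b) = false.
  by apply/negP => /(fintype.subsetP bc); rewrite inE.
by rewrite nb blkD blkN (blkZ eta) blk_Pb nb scale0r scaler0 subr0.
Qed.

Lemma blk_dx_next b st (i : 'I_n) (j : 'I_m) : (0 < block_prob D b) -> ranged st ->
  blk (dx (dual_step b st)) (inr (i, j)) = blk (dy st) (inr (i, j)) +
  if inr (i, j) \in b then
    (rho / p (inr (i, j))) *: (dprox st (i, j) - blk (dw st) (inr (i, j)))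
  else 0.
Proof.
move=> b0 rst; rewrite /= blkD (blkZ rho) blk_Pb (blk_Pi HD) blkD blkN blk_dv_next//.
case: ifP => eb; last by rewrite scale0r scaler0.
by rewrite mulmxBr dprox_range dw_range// scalerA.
Qed.

Lemma ranged_step b st : 0 < block_prob D b -> ranged st -> ranged (dual_step b st).
Proof.
move=> b0 rst i j; split.
  rewrite blk_dx_next// mulmxDr dy_range//; case: ifP => _; last by rewrite mulmx0.
  by rewrite -scalemxAr mulmxBr dprox_range dw_range.
rewrite dv_step blk_dv_next//.
by case: ifP => _; [exact: dprox_range|exact: dw_range].
Qed.

Section OneStep.
Variable lamS : edgevec.
Hypothesis Hmin : forall lam, (dual_obj D lamS <= dual_obj D lam)%E.

Definition seminorm2 (z : edgevec) : R := dot z (Pi *m z).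

Definition potential st : R := qA D (dx st) + \sum_ij ds st ij +
  sigA / 2 * seminorm2 (dv st - lamS).

Definition dual_val : R := qA D lamS + \sum_ij psiv D lamS ij.

(** The contribution of a drawn edge to the change of the potential, up to the factor 1 / p, which
    averaging over the blocks removes. *)
Definition edge_term st (e : edge) : R :=
  - rho * dot (blk (dgrad st) e) (blk (Pi *m (dw st - lamS)) e) +
  if e is inr ij then rho * (psiv D lamS ij - dsw st ij) else 0.

Lemma Pi_sym (x y : edgevec) : dot x (Pi *m y) = dot y (Pi *m x).
Proof. by rewrite dotC proj_dotC//; exact: Pi_proj. Qed.

Lemma lamS_range i j : Pij D i j *m blk lamS (inr (i, j)) = blk lamS (inr (i, j)).
Proof. by apply: (psi_ij_range HD (r := psiv D lamS (i, j))); rewrite (minimizer_psi HD Hmin). Qed.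

(** Exactly the proximal inequality at the minimizer, multiplied by rho / p; sigA eta = rho matches
    it with the distance term. *)
Lemma virtual_edge_step b st i j (e : edge := inr (i, j))
    (r := blk (dv_next b st - dw st) e) :
  0 < block_prob D b -> ranged st -> e \in b ->
  rho * ((p e)^-1 * dot (blk (dgrad st) e) (Pij D i j *m r)) +
  sigA * dot r (Pij D i j *m blk (dv_next b st - lamS) e) +
  rho / p e * (psi_fin (i, j) (dprox st (i, j)) - dsw st (i, j))
  <= (p e)^-1 * edge_term st e.
Proof.
move=> b0 rst eb; have eta0 := stepsize_gt0; have sE := sigma_stepsize.
have pe0 : 0 < p e by exact: (edge_prob_gt0 HD).
rewrite /r /edge_term /= (blk_Pi HD) !(blkD _ (- _)) !blkN blk_dv_next// -/e eb !mulmxBr.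
rewrite dprox_range dw_range// lamS_range.
have := dual_prox_le HD (blk (dw st) e - (eta / p e) *: blk (dgrad st) e) eta0
  (_ : psi_ij D i j (blk lamS e) <= (psiv D lamS (i, j))%:E)%E.
rewrite (minimizer_psi HD Hmin) lexx => /(_ isT).
rewrite -[dual_prox _ _ _ _ _]/(dprox st (i, j)).
rewrite [psi_ij _ _ _ _](psi_dprox st (i, j)) lee_fin -/e.
move: (dprox st (i, j)) => V.
move: (psi_fin (i, j) V) (psiv D lamS (i, j)) (dsw st (i, j)) => fV fL sw.
move: (blk (dw st) e) (blk (dgrad st) e) (blk lamS e) => W G L.
rewrite -(ler_pM2l (divr_gt0 rho_gt0 pe0)) => H.
rewrite -subr_ge0.
have {}H : 0 <= rho / p e * (fL - p e / eta * dot (W - (eta / p e) *: G - V) (L - V)) - rho / p e * fV.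
  by rewrite subr_ge0.
apply: le_trans H _; rewrite le_eqVlt; apply/orP; left; apply/eqP.
move: sE eta0; move: (stepsize D rho) => h <- h0; rewrite !dotL.
by field; rewrite !gt_eqF.
Qed.

Lemma dot_supported (b : block) (r z : edgevec) : (forall e, e \notin b -> blk r e = 0) ->
  dot r z = \sum_(e in b) dot (blk r e) (blk z e).
Proof.
move=> h; rewrite dot_blk [RHS]big_mkcond; apply: eq_bigr => e _.
by case: ifPn => // /h ->; rewrite dot0l.
Qed.

Lemma sum_virtual (b : block) (F : vedge -> R) : \sum_(ij | inr ij \in b) F ij =
  \sum_(e in b) if (e : edge) is inr ij then F ij else 0.
Proof.
by rewrite big_sumType/= big1_eq add0r.
Qed.

Lemma qA_add (y z : edgevec) :
  qA D (y + z) = qA D y + dot (M *m y) z + qA D z.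
Proof.
rewrite !qAE mulmxDr !dotL (dotC y (M *m z)) (dot_mul M z y) (GA_sym HD).
by rewrite (dotC z (M *m y)); lra.
Qed.

Lemma qA_ge (y z : edgevec) :
  qA D y + dot (M *m y) (z - y) + sigA / 2 * seminorm2 (z - y) <= qA D z.
Proof.
have -> : qA D z = qA D (y + (z - y)) by rewrite addrC subrK.
rewrite qA_add lerD2l qAE /seminorm2.
by have := sigmaA_le HD rho_gt0 Hrho (z - y); lra.
Qed.

Lemma seminorm2D (y z : edgevec) :
  seminorm2 (y + z) = seminorm2 y + 2 * dot z (Pi *m y) + seminorm2 z.
Proof. by rewrite /seminorm2 mulmxDr !dotL (Pi_sym y z); lra. Qed.

Lemma seminorm2_ge0 (z : edgevec) : 0 <= seminorm2 z.
Proof. by rewrite /seminorm2 -proj_dot ?dot_ge0//; exact: Pi_proj. Qed.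

(** Expanded around the new v instead of w, the distance term releases -sigA/2 |r|^2_Pi, which pays
    for the quadratic remainder of q_A by [rho_GA_le]. *)
Lemma potential_step_le b st : 0 < block_prob D b -> ranged st ->
  potential (dual_step b st) <= qA D (dy st) + \sum_ij dsy st ij +
    sigA / 2 * seminorm2 (dw st - lamS) + \sum_(e in b) (p e)^-1 * edge_term st e.
Proof.
move=> b0 rst; rewrite /potential dv_step [dx _]/(_ + _).
set r := dv_next b st - dw st.
have vE : dv_next b st - lamS = (dw st - lamS) + r.
  by rewrite [RHS]addrC addrA subrK.
rewrite vE qA_add seminorm2D big_split/= -big_mkcond/=.
have h1 : qA D (rho *: (Q b *m (Pi *m r))) <= sigA / 2 * seminorm2 r.
  rewrite qAE -scalemxAr dotZl dotZr.
  by have := rho_GA_le HD rho_gt0 Hrho r b0; rewrite /seminorm2 expr2; lra.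
suff h2 : rho * dot (Q b *m dgrad st) (Pi *m r) +
    sigA * dot r (Pi *m (dv_next b st - lamS)) +
    \sum_(ij | inr ij \in b) rho / p (inr ij) * (psi_fin ij (dprox st ij) - dsw st ij) <=
    \sum_(e in b) (p e)^-1 * edge_term st e.
  move: h2; rewrite vE (mulmxDr Pi (dw st - lamS)) (dotDr r) -/(seminorm2 r) => h2.
  rewrite dotZr -/(dgrad st) (_ : dot (dgrad st) _ = dot (Q b *m dgrad st) (Pi *m r)).
    lra.
  by rewrite dot_mulr Pb_sym.
have [bv|bnv] := boolP (b \subset virtual_edges); last first.
  have bc : b \subset comm_edges.
    by have /orP[//|bv] := block_prob_pure HD b0; rewrite bv in bnv.
  have nb ij : (inr ij \in b) = false.
    by apply/negP => /(fintype.subsetP bc); rewrite inE.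
  rewrite big_pred0// addr0.
  (* A communication block makes a plain gradient step, and sigA eta = rho turns the required
     inequality into an equality. *)
  have rE : r = - (eta *: (Q b *m dgrad st)).
    by rewrite /r /dv_next (negbTE bnv) addrC addKr.
  rewrite rE (dotNl (eta *: _)) (dotZl eta) mulrN mulrA sigma_stepsize -rE.
  have -> : \sum_(e in b) (p e)^-1 * edge_term st e =
      - rho * dot (Q b *m dgrad st) (Pi *m (dw st - lamS)).
    rewrite dot_Pb mulr_sumr; apply: eq_bigr => -[c|ij]; last by rewrite nb.
    by move=> _; rewrite /edge_term addr0; ring.
  by rewrite vE (mulmxDr Pi (dw st - lamS)) dotDr; lra.
have r0 e : e \notin b -> blk r e = 0.
  move=> eb; rewrite /r (blkD _ (- _)) blkN; apply/eqP; rewrite subr_eq0; apply/eqP.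
  case: e eb => [c|[i j]] eb; first by rewrite /dv_next bv of_blkK.
  by rewrite blk_dv_next// (negbTE eb).
rewrite (dot_supported _ r0) dot_Pb sum_virtual !mulr_sumr -!big_split/=.
apply: ler_sum => -[c|[i j]] eb.
  by have := fintype.subsetP bv _ eb; rewrite inE.
have := virtual_edge_step b0 rst eb.
by rewrite -!(blk_Pi HD).
Qed.

Lemma GA_Pi_dot (y z : edgevec) : dot (M *m y) (Pi *m z) = dot (M *m y) z.
Proof.
have [Pit _] := Pi_proj D.
rewrite dotC (proj_dotC _ _ (Pi_proj D)) dotC; congr dot.
rewrite mulmxA; congr (_ *m _).
by have := congr1 trmx (GA_Pi D); rewrite (trmx_mul M Pi) Pit (GA_sym HD).
Qed.

Lemma sum_edge_term st : \sum_e edge_term st e =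
  - rho * dot (dgrad st) (dw st - lamS) +
  rho * (\sum_ij psiv D lamS ij - \sum_ij dsw st ij).
Proof.
rewrite big_split/= -mulr_sumr -dot_blk GA_Pi_dot; congr (_ + _).
by rewrite big_sumType/= big1_eq add0r -mulr_sumr sumrB.
Qed.

Lemma seminorm2_convex (y z : edgevec) :
  seminorm2 ((1 - rho) *: y + rho *: z) <= (1 - rho) * seminorm2 y + rho * seminorm2 z.
Proof.
have r1 := rho_le1 HD rho_gt0 Hrho; have := seminorm2_ge0 (y - z).
rewrite -scaleN1r !seminorm2D /seminorm2 -!scalemxAr !(dotZl, dotZr).
have -> : dot z (Pi *m y) = dot y (Pi *m z) by rewrite Pi_sym.
move: (dot y (Pi *m y)) (dot z (Pi *m z)) (dot y (Pi *m z)) => yy zz yz h.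
have : 0 <= (rho * (1 - rho)) * (yy + 2 * (-1 * yz) + -1 * (-1 * zz)).
  by rewrite mulr_ge0// mulr_ge0 ?subr_ge0// ltW.
lra.
Qed.

Lemma potential_avg st : ranged st ->
  \sum_b block_prob D b * potential (dual_step b st) <=
  (1 - rho) * potential st + rho * dual_val.
Proof.
move=> rst; have r0 := rho_gt0; have r1 := rho_le1 HD rho_gt0 Hrho.
have s0 := sigmaA_gt0 HD rho_gt0 Hrho.
set B := qA D (dy st) + \sum_ij dsy st ij + sigA / 2 * seminorm2 (dw st - lamS).
apply: (@le_trans _ _ (B + \sum_e edge_term st e)).
  rewrite -(sum_edge_prob HD) -[B in leRHS]mul1r -(block_prob_sum1 HD) mulr_suml.
  rewrite -big_split/=; apply: ler_sum => b _; rewrite -mulrDr.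
  have := block_prob_ge0 HD b; rewrite le_eqVlt => /predU1P[<-|b0]; first by rewrite !mul0r.
  by rewrite ler_pM2l//; exact: potential_step_le.
rewrite sum_edge_term /B /potential /dual_val.
set a := dv st - lamS; set c := dy st - lamS.
have wE : dw st - lamS = (1 - rho) *: a + rho *: c.
  by apply/colP => i; rewrite !mxE; ring.
(* This is what the choice of y achieves: with weight rho at l and 1 - rho at x, the tangent terms
   at y add up to -rho <g, w - l>, as left by the step. Strong convexity towards l absorbs the term
   in |y - l|^2. *)
have xE : dx st - dy st = rho *: (c - a).
  apply/colP => i; rewrite /a /c /dy !mxE.
  by field; rewrite gt_eqF//; lra.
have lE : lamS - dy st = - c by rewrite opprB.
have := qA_ge (dy st) (dx st); have := qA_ge (dy st) lamS.
rewrite -/(dgrad st) lE xE.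
have hw := seminorm2_convex a c.
have sN : seminorm2 (- c) = seminorm2 c by rewrite /seminorm2 mulmxN dotNl dotNr opprK.
rewrite sN wE [dot _ (- c)]dotNr (dotZr rho) (dotDr _ c (- a)) (dotNr _ a).
rewrite (dotDr _ (_ *: a) (_ *: c)) (dotZr (1 - rho)) (dotZr rho).
have sd : \sum_ij dsy st ij - rho * \sum_ij dsw st ij = (1 - rho) * \sum_ij ds st ij.
  rewrite !mulr_sumr -sumrB; apply: eq_bigr => ij _; rewrite /dsw /dsy.
  by field; rewrite gt_eqF//; lra.
have := seminorm2_ge0 (rho *: (c - a)).
move: (dot (dgrad st) a) (dot (dgrad st) c) => ga gc.
move: hw; move: (seminorm2 (_ + _)) (seminorm2 a) (seminorm2 c) (seminorm2 (rho *: _))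
  => ww aa cc xx hw xx0.
move: sd; move: (\sum_ij dsy st ij) (\sum_ij dsw st ij) (\sum_ij ds st ij)
  (\sum_ij psiv D lamS ij) => Sy Sw Ss Sp' sd.
move: (qA D (dy st)) (qA D (dx st)) (qA D lamS) => qy qx ql hl hx.
have hw' := ler_wpM2l (ltW s0) hw.
have hl' := ler_wpM2l (ltW r0) hl.
have hx' : (1 - rho) * (qy + rho * (gc - ga)) <= (1 - rho) * qx.
  apply: ler_wpM2l; first lra.
  have : 0 <= sigA * xx by rewrite mulr_ge0// ltW.
  lra.
lra.
Qed.

Lemma gap_avg st : ranged st ->
  \sum_b block_prob D b * (potential (dual_step b st) - dual_val) <=
  (1 - rho) * (potential st - dual_val).
Proof.
move=> rst; under eq_bigr do rewrite mulrBr.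
rewrite sumrB -mulr_suml (block_prob_sum1 HD) mul1r.
by have := potential_avg rst; lra.
Qed.

(** When c = 1 the point u has weight 0 and nothing is known of psi there, hence the guard c < 1. *)
Definition admissible_at (ij : vedge) st : Prop :=
  exists u al, let c := rho / p (inr ij) in
  [/\ blk (dx st) (inr ij) = c *: blk (dv st) (inr ij) + (1 - c) *: u,
      ds st ij = c * dphi st ij + (1 - c) * al,
      (psi_ij D ij.1 ij.2 (blk (dv st) (inr ij)) <= (dphi st ij)%:E)%E &
      c < 1 -> (psi_ij D ij.1 ij.2 u <= al%:E)%E].

Definition admissible st := forall ij, Pij D ij.1 ij.2 != 0 -> admissible_at ij st.

(** Where Pij = 0, A does not see the edge and the step bound does not force rho <= p; there the
    block is 0 and the bounds never move. *)
Definition idle st := forall ij, Pij D ij.1 ij.2 = 0 ->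
  ds st ij = psi_fin ij 0 /\ dphi st ij = psi_fin ij 0.

Lemma psi_fin0 ij : Pij D ij.1 ij.2 = 0 -> psi_ij D ij.1 ij.2 0 = (psi_fin ij 0)%:E.
Proof.
move=> P0; have := psi_ij_point HD ij.1 ij.2 0.
rewrite /psi_point /pgrad P0 mul0mx scaler0 oppr0 => h.
by rewrite /psi_fin (psi_ij_fin HD h).
Qed.

Lemma idle_step b st : 0 < block_prob D b -> idle st -> idle (dual_step b st).
Proof.
move=> b0 ist [i j] P0; have [s0 ph0] := ist _ P0.
have prox0 : dprox st (i, j) = 0 by rewrite -dprox_range P0 mul0mx.
have r1 : 1 + rho != 0 by rewrite gt_eqF// addr_gt0.
have sy : dsy st (i, j) = psi_fin (i, j) 0 by rewrite /dsy s0 ph0; field.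
have sw : dsw st (i, j) = psi_fin (i, j) 0 by rewrite /dsw sy ph0; ring.
by rewrite /= prox0 sy sw; case: ifP => _; rewrite ?subrr ?mulr0 ?addr0.
Qed.

Lemma prob_le1 e : p e <= 1.
Proof.
rewrite -(block_prob_sum1 HD) [leRHS](bigID (fun b : block => e \in b))/= lerDl.
by apply: sumr_ge0 => b _; exact: (block_prob_ge0 HD).
Qed.

Lemma prob1_mem b e : p e = 1 -> 0 < block_prob D b -> e \in b.
Proof.
move=> p1 b0; apply: contraT => eb.
have := block_prob_sum1 HD; rewrite (bigID (fun b : block => e \in b))/=.
rewrite -/(edge_prob D e) p1 (bigD1 b)//= => h.
have : 0 <= \sum_(i : block | (e \notin i) && (i != b)) block_prob D i.
  by apply: sumr_ge0 => b' _; exact: (block_prob_ge0 HD).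
move: h b0; set X := \sum_(_ | _) _; lra.
Qed.

(** Drawing the edge adds c (V - w) to x and V - w to v, with V the proximal point, so the new x - c
    v equals y - c w in either case. For c < 1 this fixes the new u as (y - c w) / (1 - c). *)
Lemma admissible_step b st : 0 < block_prob D b -> ranged st ->
  admissible st -> admissible (dual_step b st).
Proof.
move=> b0 rst ast [i j] Pne; have [u [al [xE sE hv hu]]] := ast _ Pne.
have r0 := rho_gt0; have p0 := edge_prob_gt0 HD (inr (i, j)).
have rp := rho_le_prob HD rho_gt0 Hrho Pne; have r1 := rho_le1 HD rho_gt0 Hrho.
set c := rho / p (inr (i, j)) in xE sE hu *.
have c0 : 0 < c by rewrite divr_gt0.
have c1 : c <= 1 by rewrite ler_pdivrMr// mul1r.
have r1' : 1 + rho != 0 by rewrite gt_eqF// addr_gt0.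
set v := blk (dv st) _ in xE hv; set ph := dphi st _ in sE hv.
(* Weights of u and v in the new u ([k1], [k2]) and in w ([k3], [k4]); rho <= 1 and c <= 1 make them
   convex weights. *)
pose k1 := (1 - rho * c) / (1 + rho); pose k2 := rho * (1 + c) / (1 + rho).
pose k3 := rho * (1 - c) / (1 + rho); pose k4 := (1 + rho * c) / (1 + rho).
have [k10 k20] : 0 <= k1 /\ 0 <= k2 by split; apply: divr_ge0; nra.
have [k30 k40] : 0 <= k3 /\ 0 <= k4 by split; apply: divr_ge0; nra.
have k12 : k1 + k2 = 1 by rewrite /k1 /k2; field.
have k34 : k3 + k4 = 1 by rewrite /k3 /k4; field.
have yE : blk (dy st) (inr (i, j)) = (1 + rho)^-1 *: (((1 - c) *: u + c *: v) + rho *: v).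
  by rewrite /dy blkZ blkD blkZ xE -/v (addrC (c *: v)).
have wE : blk (dw st) (inr (i, j)) = k3 *: u + k4 *: v.
  rewrite /dw blkD (blkZ (1 - rho)) (blkZ rho) yE -/v.
  by apply/colP => a; rewrite !mxE /k3 /k4; field.
have syE : dsy st (i, j) = (1 + rho)^-1 * ((1 - c) * al + c * ph + rho * ph).
  by rewrite /dsy sE -/ph; ring.
have swE : dsw st (i, j) = k3 * al + k4 * ph.
  by rewrite /dsw syE -/ph /k3 /k4; field.
have hw : (psi_ij D i j (k3 *: u + k4 *: v)%R <= (k3 * al + k4 * ph)%:E)%E.
  have [cc|cc] := ltP c 1; first exact: (psi_ij_convex HD (hu cc) hv).
  have ce : c = 1 by apply/eqP; rewrite eq_le c1 cc.
  have k30' : k3 = 0 by rewrite /k3 ce subrr mulr0 mul0r.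
  by move: k34; rewrite k30' add0r => ->; rewrite scale0r add0r scale1r mul0r add0r mul1r.
exists (k1 *: u + k2 *: v), (k1 * al + k2 * ph).
rewrite -/c blk_dx_next// dv_step blk_dv_next// ds_step dphi_step.
rewrite wE swE yE syE /k1 /k2 /k3 /k4 -/c; split.
- by case: ifP => _; move: (dprox st (i, j)) => V; apply/colP => a; rewrite !mxE; field.
- by case: ifP => _; field.
- by case: ifP => _ //; rewrite psi_dprox.
- by move=> cc; apply: (psi_ij_convex HD (hu cc) hv).
Qed.

(* With rho = 1 every active edge belongs to every block, so one step forgets the
   initial point, even when psi is infinite there. *)
Lemma admissible_step1 b st : rho = 1 -> 0 < block_prob D b -> ranged st ->
  admissible (dual_step b st).
Proof.
move=> rE b0 rst [i j] Pne.
have rp := rho_le_prob HD rho_gt0 Hrho Pne.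
have p1 : p (inr (i, j)) = 1 by apply/eqP; rewrite eq_le prob_le1 -rE.
have eb := prob1_mem p1 b0.
have c1 : rho / p (inr (i, j)) = 1 by rewrite p1 rE divr1.
have yw : blk (dy st) (inr (i, j)) = blk (dw st) (inr (i, j)).
  by rewrite /dw rE subrr scale0r add0r scale1r.
have sysw : dsy st (i, j) = dsw st (i, j).
  by rewrite /dsw rE subrr mul0r add0r mul1r.
exists 0, 0; cbv zeta; rewrite c1 subrr ltxx scale1r scale0r addr0 mul1r mul0r addr0.
rewrite blk_dx_next// dv_step blk_dv_next// ds_step dphi_step eb c1 yw sysw scale1r mul1r.
by split=> //; rewrite ?(psi_dprox st (i, j))// ?[_ + (_ - _)]addrC ?subrK.
Qed.

Lemma potential_ge st : ranged st -> idle st -> admissible st ->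
  dual_val + sigA / 2 * seminorm2 (dv st - lamS) <= potential st.
Proof.
move=> rst ist ast; rewrite /potential lerD2r.
apply: (minimizer_le HD Hmin) => -[i j] /=.
have [P0|Pne] := eqVneq (Pij D i j) 0.
  have [-> _] := ist (i, j) P0.
  have [<- _] := rst i j.
  by rewrite P0 mul0mx (@psi_fin0 (i, j) P0).
have [u [al [-> -> hv hu]]] := ast (i, j) Pne.
have r0 := rho_gt0; have p0 := edge_prob_gt0 HD (inr (i, j)).
have rp := rho_le_prob HD rho_gt0 Hrho Pne.
set c := rho / _ in hu *.
have c0 : 0 <= c by rewrite ltW// divr_gt0.
have c1 : c <= 1 by rewrite ler_pdivrMr// mul1r.
have [cc|cc] := ltP c 1.
  by apply: (psi_ij_convex HD hv (hu cc)); lra.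
have -> : c = 1 by apply/eqP; rewrite eq_le c1 cc.
by rewrite subrr scale1r scale0r addr0 mul1r mul0r addr0.
Qed.

End OneStep.
End DualIterates.

(** * From dual to node iterates *)

Section Correspondence.
Context {R : realType} {n m d E : nat} (D : adfs_data R n m d E).
Hypothesis HD : adfs_assumptions D.
Variables (rho : R) (rho_gt0 : 0 < rho).
Hypothesis Hrho : ((rho ^+ 2)%:E <=
  \big[Order.min/+oo]_(b : {set edge n m E} | (0 < block_prob D b)%R) step_bound D b)%E.

Local Notation edge := (edge n m E).
Local Notation block := {set edge}.
Local Notation A := (Amx D).
Local Notation Q b := (pinv (Pb D b)).
Local Notation p := (edge_prob D).
Local Notation eta := (stepsize D rho).
Local Notation mu i j := (weight D (inr (i, j))).

Lemma adfs_yE st : adfs_y rho (A *m dx st) (A *m dv st) = A *m dy rho st.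
Proof. by rewrite /adfs_y /dy -scalemxAr mulmxDr -scalemxAr. Qed.

Lemma adfs_zE b st :
  adfs_z D rho b (A *m dv st) (A *m dy rho st) =
  A *m (dw rho st - eta *: (Q b *m dgrad D rho st)).
Proof.
rewrite /adfs_z mulmxBr /dw (mulmxDr A (_ *: _)) -(scalemxAr (1 - rho)).
rewrite -(scalemxAr rho) -(scalemxAr eta); congr (_ - _ *: _).
by rewrite /Wb /dgrad /GA !mulmxA.
Qed.

(** The algorithm gives to node i what its virtual nodes lose. This is how A acts on a change of the
    edge (i, j), its column having mu Pij at i and -mu Pij at (i, j). *)
Lemma adfs_vE b st : 0 < block_prob D b -> ranged D st ->
  adfs_v D rho b (A *m (dw rho st - eta *: (Q b *m dgrad D rho st))) =
  A *m dv_next D rho b st.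
Proof.
move=> b0 rst; rewrite /adfs_v; case: ifP => bv; last by rewrite /dv_next bv.
move zE0 : (dw rho st - _) => z.
have zr i j : Pij D i j *m blk z (inr (i, j)) = blk z (inr (i, j)).
  rewrite -zE0 (blkD (dw rho st)) blkN (blkZ eta) blk_Pb mulmxBr -!scalemxAr.
  by rewrite dw_range// GA_range.
have zE i j : inr (i, j) \in b -> blk z (inr (i, j)) =
    blk (dw rho st) (inr (i, j)) - (eta / p (inr (i, j))) *: blk (dgrad D rho st) (inr (i, j)).
  by move=> eb; rewrite -zE0 (blkD (dw rho st)) blkN (blkZ eta) blk_Pb eb scalerA.
have zw e : e \notin b -> blk z e = blk (dw rho st) e.
  by move=> eb; rewrite -zE0 (blkD (dw rho st)) blkN (blkZ eta) blk_Pb (negbTE eb) scale0r scaler0 subr0.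
have vE i j : inr (i, j) \in b -> prox_edge D rho i j (blk (A *m z) (inr (i, j))) =
    - (mu i j *: dprox D rho st (i, j)).
  by move=> eb; rewrite (blk_Amx_virt HD) zr (prox_edgeE HD) (zE _ _ eb).
have V i j : blk (A *m dv_next D rho b st) (inr (i, j)) =
    if inr (i, j) \in b then prox_edge D rho i j (blk (A *m z) (inr (i, j)))
    else blk (A *m z) (inr (i, j)).
  rewrite (blk_Amx_virt HD) blk_dv_next//; case: ifPn => eb.
    by rewrite (dprox_range HD rho_gt0 Hrho) vE.
  by rewrite (blk_Amx_virt HD) zw.
apply: blk_inj => -[i|[i j]]; rewrite of_blkK; last by rewrite V.
have -> : dv_next D rho b st = z + (dv_next D rho b st - z) by rewrite addrC subrK.
rewrite mulmxDr blkD; congr (_ + _).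
have dE e : blk (dv_next D rho b st - z) e = match e with
    | inl _ => 0
    | inr ij => if inr ij \in b then dprox D rho st ij - blk z (inr ij) else 0
    end.
  rewrite (blkD _ (- z)) blkN; case: e => [c|[k j]].
    rewrite zw ?/dv_next ?bv ?of_blkK ?subrr//.
    by apply/negP => /(fintype.subsetP bv); rewrite inE.
  rewrite blk_dv_next//; case: ifPn => // eb.
  by rewrite zw// subrr.
rewrite (blk_Amx HD) [RHS]big_sumType/= [X in _ = X + _]big1 ?add0r => [|c _]; last first.
  by rewrite dE mulmx0 scaler0.
pose H k j := (mu k j * (i == k)%:R) *:
  (Pij D k j *m blk (dv_next D rho b st - z) (inr (k, j))).
rewrite (eq_bigr (fun q => H q.1 q.2)) => [|[k j] _]; last first.
  by rewrite /H /= subr0 (inj_eq inl_inj).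
rewrite -(pair_bigA _ H)/= (bigD1 i)//= [X in _ = _ + X]big1 ?addr0 => [|k ki]; last first.
  by apply: big1 => j _; rewrite /H eq_sym (negbTE ki) mulr0 scale0r.
rewrite [LHS]big_mkcond; apply: eq_bigr => j _; rewrite /H eqxx mulr1 dE.
case: ifPn => eb; last by rewrite mulmx0 scaler0.
rewrite vE// (blk_Amx_virt HD) mulmxBr (dprox_range HD rho_gt0 Hrho).
by rewrite eb opprK scalerBr addrC.
Qed.

Lemma adfs_stepE b st : 0 < block_prob D b -> ranged D st ->
  adfs_step D rho b (A *m dx st, A *m dv st) =
  (A *m dx (dual_step D rho b st), A *m dv (dual_step D rho b st)).
Proof.
move=> b0 rst; rewrite /adfs_step adfs_yE adfs_zE adfs_vE//; congr pair.
rewrite /adfs_x [dx _](erefl : _ = dy rho st + rho *: (Q b *m (rowproj D *m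
  (dv_next D rho b st - dw rho st)))) (mulmxDr A (dy rho st)) -(scalemxAr rho).
congr (_ + _ *: _).
rewrite /Wtb /rowproj -!mulmxA; do 3 congr (_ *m _).
by rewrite mulmxBr /dw (mulmxDr A (_ *: _)) -(scalemxAr (1 - rho)) -(scalemxAr rho) opprD addrA.
Qed.

End Correspondence.

(** * Expectations over independent blocks *)

Section IidExpectation.
Context {R : realType} {T : finType} (p : T -> R).
Hypothesis p_ge0 : forall b, 0 <= p b.

(** The newest block, at the head of the list, is averaged innermost, so a one-step inequality
    applies under the mean over the past. *)
Fixpoint mean t (g : seq T -> R) : R :=
  if t is s.+1 then mean s (fun l => \sum_b p b * g (b :: l)) else g [::].

(* The most recent block comes first. *)
Fixpoint history (bs : nat -> T) t : seq T :=
  if t is s.+1 then bs s :: history bs s else [::].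

(** Restricted to histories of positive probability, since purity and the step bound are assumed
    only for blocks that can be drawn. *)
Lemma mean_le t g1 g2 :
  (forall l, size l = t -> all (fun b => 0 < p b) l -> g1 l <= g2 l) ->
  mean t g1 <= mean t g2.
Proof.
elim: t g1 g2 => [|t IH] g1 g2 h /=; first exact: h.
apply: IH => l lt lp; apply: ler_sum => b _.
have := p_ge0 b; rewrite le_eqVlt => /predU1P[<-|b0]; first by rewrite !mul0r.
by rewrite ler_pM2l// h//= ?lt// b0.
Qed.

Lemma meanZ t c g : mean t (fun l => c * g l) = c * mean t g.
Proof.
elim: t g => [|t IH] g //=; rewrite -IH; congr mean; apply/funext => l.
by rewrite mulr_sumr; apply: eq_bigr => b _; rewrite mulrCA.
Qed.

Lemma mean_sum t (g : T -> seq T -> R) :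
  mean t (fun l => \sum_b p b * g b l) = \sum_b p b * mean t (g b).
Proof.
elim: t g => [|t IH] g //=; rewrite -IH; congr mean; apply/funext => l.
under eq_bigr do rewrite mulr_sumr.
rewrite exchange_big; apply: eq_bigr => b _; rewrite mulr_sumr.
by apply: eq_bigr => c _; rewrite mulrCA.
Qed.

Section Probability.
Context {disp : measure_display} {Omega : measurableType disp}.
Variables (Pr : probability Omega R) (B : nat -> Omega -> T).
Hypothesis Bmeas : forall s (C : set T), measurable (B s @^-1` C).
Hypothesis Blaw : forall s b, Pr (B s @^-1` [set b]) = (p b)%:E.
Hypothesis Bindep : forall (S : seq nat) (C : nat -> set T), uniq S ->
  Pr (\bigcap_(s in [set` S]) (B s @^-1` C s)) =
  (\prod_(s <- S) Pr (B s @^-1` C s))%E.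

Let hist w t := history (B ^~ w) t.

(** The blocks drawn from time t on begin with l, oldest first, opposite to the order of
    [history]. *)
Let event t l : set Omega :=
  \bigcap_(s in [set` iota t (size l)]) (B s @^-1` [set b | onth l (s - t) = Some b]).

Let event_measurable t l : measurable (event t l).
Proof. by apply: fin_bigcap_measurable => // s _; exact: Bmeas. Qed.

Let event_cons t b l w : event t (b :: l) w <-> B t w = b /\ event t.+1 l w.
Proof.
split=> [h|[Bb h] s /=].
  split=> [|s /= sl].
    have := h t; rewrite /= mem_head subnn /= => /(_ isT); by case=> ->.
  have ts : (t < s)%N by move: sl; rewrite mem_iota => /andP[].
  have := h s; rewrite /= inE sl orbT => /(_ isT).
  by rewrite -(subnSK ts).
rewrite inE => /predU1P[->|sl]; first by rewrite subnn /= Bb.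
have ts : (t < s)%N by move: sl; rewrite mem_iota => /andP[].
by have := h s sl; rewrite /= -(subnSK ts).
Qed.

Let prob_event t l : Pr (event t l) = (\prod_(b <- l) p b)%:E.
Proof.
rewrite /event Bindep ?iota_uniq//.
elim: l t => [|b l IH] t /=; first by rewrite !big_nil.
rewrite !big_cons EFinM -(IH t.+1) subnn; congr (_ * _)%E.
  by rewrite -(Blaw t b); congr (Pr _); apply/seteqP; split=> w /= => [[->]|->].
rewrite !big_seq; apply: eq_bigr => s; rewrite mem_iota => /andP[ts _].
by rewrite -(subnSK ts).
Qed.

Let measurable_hist t (g : seq T -> R) :
  measurable_fun [set: Omega] (fun w => g (hist w t)).
Proof.
elim: t g => [|t IH] g; first exact: (measurable_cst (g [::])).
rewrite (_ : (fun w => _) = fun w => \sum_b \1_(B t @^-1` [set b]) w * g (b :: hist w t)).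
  apply: measurable_sum => b; apply: measurable_funM; last exact: (IH (fun k => g (b :: k))).
  exact: measurable_indic.
apply/funext => w; rewrite (bigD1 (B t w))//= big1 ?addr0 => [|b bw].
  by rewrite indicE mem_set// mul1r.
by rewrite indicE memNset ?mul0r// => /= /esym/eqP; apply/negP.
Qed.

(** Splitting on the newest block of the history moves it into the cylinder event, which grows
    towards the past; independence enters once, when the history is empty. *)
Let integral_event t l g : (forall k, 0 <= g k) ->
  (\int[Pr]_w (\1_(event t l) w * g (hist w t))%:E)%E =
  ((\prod_(b <- l) p b) * mean t g)%:E.
Proof.
elim: t l g => [|t IH] l g g0 /=.
  rewrite (eq_integral (fun w => (g [::])%:E * (\1_(event 0 l) w)%:E)%E); last first.
    by move=> w _; rewrite -EFinM mulrC.
  rewrite ge0_integralZl_EFin//; last exact/measurable_EFinP/measurable_indic.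
  by rewrite integral_indic// setIT [X in (_ * X)%E](prob_event 0 l) -EFinM mulrC.
rewrite (eq_integral (fun w => \sum_b (\1_(event t (b :: l)) w * g (b :: hist w t))%:E)%E); last first.
  move=> w _; rewrite sumEFin; congr EFin.
  rewrite (bigD1 (B t w))//= big1 ?addr0 => [|b bw].
    congr (_ * _); rewrite !indicE; congr (_%:R); congr nat_of_bool.
    by apply/idP/idP => /set_mem h; apply/mem_set; [exact/event_cons|case/event_cons: h].
  by rewrite indicE memNset ?mul0r// => /event_cons[/esym/eqP bE _]; rewrite bE in bw.
rewrite ge0_integral_sum//=; first last.
- by move=> b w _; rewrite lee_fin mulr_ge0// indicE.
- move=> b; apply/measurable_EFinP; apply: measurable_funM.
    exact: measurable_indic.
  exact: (measurable_hist t (fun k => g (b :: k))).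
under eq_bigr do rewrite (IH (_ :: l) (fun k => g (_ :: k)))//.
rewrite sumEFin mean_sum mulr_sumr; congr EFin; apply: eq_bigr => b _.
by rewrite big_cons mulrCA mulrA.
Qed.

Lemma expectation_history t g : (forall k, 0 <= g k) ->
  ('E_Pr[fun w => g (history (B ^~ w) t)])%E = (mean t g)%:E.
Proof.
move=> g0; have := integral_event t [::] g0; rewrite big_nil mul1r unlock => <-.
apply: eq_integral => w _; rewrite indicE mem_set ?mul1r// => s /=.
Qed.

End Probability.
End IidExpectation.

(** * Convergence *)

Section Convergence.
Context {R : realType} {n m d E : nat} (D : adfs_data R n m d E).
Hypothesis HD : adfs_assumptions D.
Variables (rho : R) (rho_gt0 : 0 < rho).
Hypothesis Hrho : ((rho ^+ 2)%:E <=
  \big[Order.min/+oo]_(b : {set edge n m E} | (0 < block_prob D b)%R) step_bound D b)%E.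
Variable lamS : edgevec R n m d E.
Hypothesis Hmin : forall lam, (dual_obj D lamS <= dual_obj D lam)%E.
Variable theta_star : 'cV[R]_d.
Hypothesis Hstar : forall x, primal_obj D theta_star <= primal_obj D x.

Local Notation edgevec := (edgevec R n m d E).
Local Notation block := {set edge n m E}.
Local Notation A := (Amx D).
Local Notation Sp := (pinv (Sigma D)).
Local Notation Pi := (rowproj D).
Local Notation sigA := (sigmaA D).
Local Notation lmax := (lambda_max (A^T *m (Sp *m Sp) *m A)).

(** Where psi is infinite at 0, [psi_fin] is the default 0 and bounds nothing; the contraction of
    the gap is unaffected. *)
Definition dual_start : @dual_state R n m d E :=
  DualState 0 0 (fun ij => psi_fin D ij 0) (fun ij => psi_fin D ij 0).

Definition dual_run (l : seq block) := foldr (dual_step D rho) dual_start l.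

Definition positive_history (l : seq block) := all (fun b => 0 < block_prob D b) l.

Lemma ranged_start : ranged D dual_start.
Proof. by move=> i j; rewrite !blk0 mulmx0. Qed.

Lemma dual_run_inv l : positive_history l ->
  [/\ ranged D (dual_run l), idle D (dual_run l) &
    foldr (adfs_step D rho) (0, 0) l = (A *m dx (dual_run l), A *m dv (dual_run l))].
Proof.
elim: l => [|b l IH] /=; first by split; [exact: ranged_start| |rewrite !mulmx0].
move=> /andP[b0 /IH[rl il ->]]; split.
- exact: (ranged_step HD rho_gt0 Hrho).
- exact: (idle_step HD rho_gt0 Hrho).
- exact: (adfs_stepE HD rho_gt0 Hrho).
Qed.

Lemma admissible_run l : positive_history l ->
  admissible D rho dual_start \/ rho = 1 /\ (0 < size l)%N ->
  admissible D rho (dual_run l).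
Proof.
elim: l => [|b l IH] /=; first by move=> _ [//|[_]].
move=> /andP[b0 pl] h; have [rl _ _] := dual_run_inv pl.
case: h => [a0|[r1 _]]; last exact: (admissible_step1 HD rho_gt0 Hrho).
by apply: (admissible_step HD rho_gt0 Hrho) => //; apply: IH => //; left.
Qed.

Definition gap st := potential D lamS st - dual_val D lamS.

Lemma mean_gap t :
  mean (block_prob D) t (fun l => gap (dual_run l)) <= (1 - rho) ^+ t * gap dual_start.
Proof.
elim: t => [|t IH] /=; first by rewrite mul1r.
rewrite exprS -mulrA; apply: le_trans (_ : (1 - rho) * _ <= _); last first.
  by apply: ler_wpM2l IH; rewrite subr_ge0 (rho_le1 HD rho_gt0 Hrho).
rewrite -meanZ; apply: (mean_le (block_prob_ge0 HD)) => l _ /dual_run_inv[rl _ _].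
exact: (gap_avg HD rho_gt0 Hrho Hmin).
Qed.

(** Origin of the first factor of the constant. The eigenvalue bound is applied to Pi z, which has
    the same image under A, so that the seminorm appears. *)
Lemma lmax_ub (z : edgevec) : dot (Sp *m (A *m z)) (Sp *m (A *m z)) <= lmax * seminorm2 D z.
Proof.
have St : (A^T *m (Sp *m Sp) *m A)^T = A^T *m (Sp *m Sp) *m A.
  rewrite !trmx_mul trmxK (pinv_Sigma_sym HD) mulmxA.
  by rewrite !mulmxA.
have SE y : dot y (A^T *m (Sp *m Sp) *m A *m y) = dot (Sp *m (A *m y)) (Sp *m (A *m y)).
  have -> : A^T *m (Sp *m Sp) *m A *m y = A^T *m (Sp *m (Sp *m (A *m y))) by rewrite !mulmxA.
  by rewrite -dot_mul dot_mulr (pinv_Sigma_sym HD).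
have := lambda_max_ub (Pi *m z) St; rewrite SE (proj_dot _ _ (Pi_proj D)).
by have -> : A *m (Pi *m z) = A *m z by rewrite mulmxA Amx_Pi.
Qed.

(** Strict positivity keeps the constant infinite when F*(0) = +oo, since 0 times +oo would be 0. *)
Lemma lmax_gt0 : 0 < lmax.
Proof.
have /matrix0Pn[k [l Pkl]] := Pi_neq0 HD rho_gt0 Hrho.
pose x : edgevec := delta_mx l 0.
have Px0 : Pi *m x != 0.
  by apply/eqP => /colP/(_ k)/eqP;
    rewrite /x -colE [X in _ == X]mxE [X in X == _]mxE (negbTE Pkl).
have y0 : 0 < dot (Sp *m (A *m x)) (Sp *m (A *m x)).
  apply: dot_gt0; apply: contra_neq Px0 => /(pinv_Sigma_Amx_eq0 HD) Ax0.
  by rewrite /rowproj -mulmxA Ax0 mulmx0.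
have := lt_le_trans y0 (lmax_ub x).
by have := seminorm2_ge0 D x; nra.
Qed.

Lemma primal_error_le (z : edgevec) :
  \sum_(i < n) sqnorm (blk (Sp *m (A *m z)) (inl i) - theta_star) <=
  lmax * seminorm2 D (z - lamS).
Proof.
apply: le_trans (lmax_ub _); rewrite dot_blk big_sumType/= ler_wpDr//.
  by apply: sumr_ge0 => j _; exact: dot_ge0.
apply: ler_sum => i _; rewrite sqnormE -(primal_dual_optimality HD Hmin i Hstar).
by rewrite -blkN -blkD -!mulmxBr.
Qed.

Definition error_at (l : seq block) : R :=
  \sum_(i < n) sqnorm (blk (Sp *m (foldr (adfs_step D rho) (0, 0) l).2) (inl i) - theta_star).

(** The factor 2 / sigA inverts the coefficient of the distance in the potential. The disjunction
    gives the two ways for the carried numbers to majorise psi at time t. *)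
Lemma mean_error t :
  admissible D rho dual_start \/ rho = 1 /\ (0 < t)%N ->
  mean (block_prob D) t error_at <= lmax * (2 / sigA) * ((1 - rho) ^+ t * gap dual_start).
Proof.
move=> h; have s0 := sigmaA_gt0 HD rho_gt0 Hrho; have l0 := lmax_gt0.
have c0 : 0 <= lmax * (2 / sigA) by rewrite mulr_ge0 ?divr_ge0// ltW.
apply: le_trans (ler_wpM2l c0 (mean_gap t)); rewrite -meanZ.
apply: (mean_le (block_prob_ge0 HD)) => l lt lp; have [rl il fE] := dual_run_inv lp.
have al : admissible D rho (dual_run l) by apply: admissible_run; rewrite ?lt.
rewrite /error_at fE; apply: le_trans (primal_error_le _) _.
have := potential_ge HD rho_gt0 Hrho Hmin rl il al.
rewrite /gap => H; rewrite -(mulrA lmax); apply: ler_wpM2l; first exact: ltW.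
rewrite mulrAC ler_pdivlMr//; lra.
Qed.

Lemma adfs_iter_history (bs : nat -> block) t :
  adfs_iter D rho bs t = foldr (adfs_step D rho) (0, 0) (history bs t).
Proof. by elim: t => //= t ->. Qed.

Lemma gap_start : gap dual_start =
  \sum_ij psi_fin D ij 0 - dual_val D lamS + sigA / 2 * seminorm2 D lamS.
Proof.
rewrite /gap /potential /= qAE mulmx0 dot0r mulr0 add0r sub0r.
by rewrite /seminorm2 mulmxN dotNl dotNr opprK; ring.
Qed.

End Convergence.

Theorem theorem6p1 (R : realType) (n m d E : nat) (D : adfs_data R n m d E)
    (HD : adfs_assumptions D)
    (disp : measure_display) (Omega : measurableType disp)
    (Pr : probability Omega R) (B : nat -> Omega -> {set edge n m E})
    (HB : iid_blocks D Pr B)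
    (theta_star : 'cV[R]_d)
    (Hstar : forall x, primal_obj D theta_star <= primal_obj D x)
    (thetaA_star : edgevec R n m d E)
    (HstarA : forall lam, (dual_obj D thetaA_star <= dual_obj D lam)%E)
    (rho : R) (rho_gt0 : 0 < rho)
    (Hrho : ((rho ^+ 2)%:E <=
             \big[Order.min/+oo]_(b : {set edge n m E} | (0 < block_prob D b)%R) step_bound D b)%E)
    (t : nat) :
  ('E_Pr[fun w => (\sum_(i < n)
       sqnorm (blk (theta_out D rho (fun s => B s w) t) (inl i) - theta_star))%R]
   <= C0 D thetaA_star * ((1 - rho) ^+ t)%:E)%E.
Proof.
have [Bm Bl Bi] := HB.
have s0 := sigmaA_gt0 HD rho_gt0 Hrho; have l0 := lmax_gt0 HD rho_gt0 Hrho.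
rewrite (_ : (fun w => _) = fun w => error_at D rho theta_star (history (B ^~ w) t)); last first.
  by apply/funext => w; rewrite /error_at /theta_out adfs_iter_history.
rewrite (expectation_history Bm Bl Bi); last first.
  by move=> l; apply: sumr_ge0 => i _; rewrite sqnormE dot_ge0.
have [_ valE] := minimizer_fin HD HstarA; rewrite -/(dual_val D thetaA_star) in valE.
rewrite /C0 valE -/(rowproj D).
have -> : sqnorm (rowproj D *m thetaA_star) = seminorm2 D thetaA_star.
  by rewrite sqnormE proj_dot//; exact: Pi_proj.
case d0 : (dual_obj D 0) => [r| |]; last first.
- by have := HstarA 0; rewrite d0 valE.
- have := rho_le1 HD rho_gt0 Hrho; rewrite le_eqVlt => /predU1P[r1|rlt1].
    (* For rho = 1 the rate is 0^t: at t = 0 it is 1 and the bound is +oo; afterwards the bound is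
       +oo times 0, that is 0, so the error must vanish exactly. *)
    case: t => [|t].
      by rewrite expr0 mule1 addye// gt0_muley ?lte_fin ?mulr_gt0 ?invr_gt0// addey// gt0_muley ?leey.
    have := mean_error HD rho_gt0 Hrho HstarA Hstar (or_intror (conj r1 (ltn0Sn t))).
    by rewrite r1 subrr exprS mul0r mul0r mulr0 mule0 lee_fin.
  rewrite addye// gt0_muley ?lte_fin ?mulr_gt0 ?invr_gt0// addey// gt0_muley//.
  by rewrite gt0_mulye ?leey// lte_fin exprn_gt0// subr_gt0.
have d0r : (dual_obj D 0 <= r%:E)%E by rewrite d0.
have [psi0 d0E] := dual_obj_fin HD d0r.
have rE : r = \sum_ij psi_fin D ij 0.
  move: d0; rewrite d0E => -[<-]; rewrite qAE mulmx0 dot0r mulr0 add0r.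
  by apply: eq_bigr => ij _; rewrite /psiv /psi_fin blk0.
have ad : admissible D rho (dual_start D).
  move=> ij _; exists 0, (psi_fin D ij 0); cbv zeta; rewrite /= !blk0 !scaler0 addr0.
  have psiE : psi_ij D ij.1 ij.2 0 = (psi_fin D ij 0)%:E.
    by have := psi0 ij; rewrite /psiv blk0.
  by split=> //; rewrite ?psiE//; ring.
have := mean_error HD rho_gt0 Hrho HstarA Hstar (or_introl _ ad : _ \/ (rho = 1 /\ (0 < t)%N)).
rewrite gap_start -rE => h.
rewrite -EFinB -!EFinM lee_fin; apply: le_trans h _.
rewrite le_eqVlt; apply/orP; left; apply/eqP.
by field; rewrite gt_eqF.
Qed.
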